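(* Let $K$ be a (polyhedral) map on a surface and let $M$ be its dual map. Then the edge graph $EG(K)$ has a contractible Hamiltonian cycle if and only if the edge graph $EG(M)$ has a proper tree.
   Context: A surface is a connected compact 2-manifold without boundary. A map on a surface $S$ is an embedding of a finite simple graph $G$ in $S$ such that the closures of the components of $S\setminus G$ (the facets or faces) are polygonal 2-disks (each with at least 3 sides); its edge graph $EG$ is $G$. The map is polyhedral if any two facets meet in either the empty set, a single vertex, or a single edge (here ''map'' means polyhedral map). The dual map $M$ of $K$ is the map on the same surface whose vertices are the facets of $K$, two being joined by an edge iff the corresponding facets of $K$ share an edge; faces of $M$ correspond to vertices of $K$. A cycle in $EG(K)$ is contractible if it bounds a 2-disk in the surface. Let $K$ have $n$ vertices. A tree $T$ in $EG(M)$ with vertex set $\{v_1,\dots,v_k\}$ is a proper tree if: (1) $\sum_{i=1}^k \deg(v_i)=n+2(k-1)$, where $\deg$ is the degree in $EG(M)$; (2) whenever two vertices $u_1,u_2$ of $T$ lie on a face $F$ of $M$, a path joining $u_1$ and $u_2$ in the boundary $\partial F$ of $F$ is part of $T$; (3) every path in $T$ that lies in a face $F$ of $M$ has length at most $q-2$, where $q$ is the length of $\partial F$. *)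

(* Defs.v *)
From mathcomp Require Import all_boot.

Set Implicit Arguments.
Unset Strict Implicit.
Unset Printing Implicit Defensive.

(* Finite simple graphs are relations on a finType; the length of the path    *)
(* [x :: p] is [size p].                                                      *)

Section Graph.

Variable T : finType.
Implicit Types (g t : rel T) (S : {set T}) (x : T) (c p : seq T).

Definition deg g x : nat := #|[set y | g x y]|.

Definition simple_path g x p : bool := path g x p && uniq (x :: p).

Definition is_cycle g c : bool := (2 < size c) && ucycleb g c.

Definition hamiltonian_cycle g c : Prop := is_cycle g c /\ forall x, x \in c.

(* [t] is the adjacency relation of the subgraph with vertex set [S]. *)
Record is_tree_in g S t : Prop := IsTreeIn {
  tree_sym : symmetric t;
  tree_sub : forall x y, t x y -> [&& x \in S, y \in S & g x y];
  tree_nonempty : S != set0;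
  tree_connected : {in S &, forall x y, connect t x y};
  tree_acyclic : forall c, ~~ is_cycle t c
}.

End Graph.

(* Finite 2-dimensional regular cell complexes, given by their face posets.   *)
(* A regular complex is determined up to homeomorphism by its face poset, so  *)
(* the maps on closed surfaces (orientable or not) all of whose facets are    *)
(* closed polygonal disks are exactly the complexes satisfying [is_map].      *)

Record cellcx := CellCx {
  vert : finType;
  edge : finType;
  facet : finType;
  ve : vert -> edge -> bool;
  ef : edge -> facet -> bool
}.

Section Complex.

Variable K : cellcx.
Implicit Types (v : vert K) (e : edge K) (f : facet K).

Definition vf v f : bool := [exists e, ve v e && ef e f].

Definition ends e : {set vert K} := [set v | ve v e].

Definition sides f : {set edge K} := [set e | ef e f].

(* Edges have two ends and the boundary of every facet is a single cycle. *)
Record regular_cx : Prop := RegularCx {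
  edge_ends : forall e, #|ends e| = 2;
  facet_sides : forall f, sides f != set0;
  facet_two : forall v f, vf v f -> #|[set e | ve v e && ef e f]| = 2;
  facet_connected : forall f, {in sides f &, forall e e',
    connect [rel x y | [&& ef x f, ef y f & [exists v, ve v x && ve v y]]] e e'}
}.

Definition EG : rel (vert K) :=
  [rel u v | (u != v) && [exists e, ve u e && ve v e]].

Definition bdry f : rel (vert K) :=
  [rel u v | (u != v) && [exists e, [&& ve u e, ve v e & ef e f]]].

End Complex.

Definition dual (K : cellcx) : cellcx :=
  @CellCx (facet K) (edge K) (vert K) (fun f e => ef e f) (fun e v => ve v e).

(* [regular_cx (dual K)] says that every edge lies on exactly two facets and  *)
(* that the edges and facets around every vertex form a single cycle, i.e.,   *)
(* that the underlying space is a closed 2-manifold.                          *)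
Record is_map (K : cellcx) : Prop := IsMap {
  map_regular : regular_cx K;
  map_manifold : regular_cx (dual K);
  map_nonempty : 0 < #|vert K|;
  map_connected : forall u v : vert K, connect (@EG K) u v;
  map_simple : injective (@ends K);
  map_sides : forall f : facet K, 3 <= #|sides f|
}.

Definition common_verts (K : cellcx) (f g : facet K) : {set vert K} :=
  [set v | vf v f && vf v g].

Definition polyhedral (K : cellcx) : Prop := forall f g : facet K, f != g ->
  [\/ common_verts f g = set0,
      (exists v, common_verts f g = [set v]) /\ sides f :&: sides g = set0
    | exists e, common_verts f g = ends e /\ sides f :&: sides g = [set e]].

Definition polyhedral_map (K : cellcx) : Prop := is_map K /\ polyhedral K.

Lemma vf_dual (K : cellcx) (v : vert K) (f : facet K) :
  @vf (dual K) f v = vf v f.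
Proof. by apply/existsP/existsP => -[e]; rewrite andbC => he; exists e. Qed.

Lemma dual_polyhedral_map (K : cellcx) :
  polyhedral_map K -> polyhedral_map (dual K).
Proof.
case=> -[R R' NE CN SI SD] PH.
have vfI (v : vert K) e f : ve v e -> ef e f -> vf v f.
  by move=> ve_ ef_; apply/existsP; exists e; rewrite ve_.
have vnf (v : vert K) : exists e, ve v e.
  by have /set0Pn [e] := facet_sides R' v; rewrite inE; exists e.
have uniqE (f g : facet K) e e' : f != g ->
    ef e f -> ef e g -> ef e' f -> ef e' g -> e = e'.
  move=> fg h1 h2 h3 h4.
  have C x : ef x f -> ef x g -> x \in sides f :&: sides g.
    by move=> ? ?; rewrite !inE; apply/andP.
  case: (PH f g fg) => [h0|[_ h0]|[d [_ hd]]].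
  - have /card_gt0P [v] : 0 < #|ends e| by rewrite (edge_ends R).
    rewrite inE => hv; have : v \in common_verts f g.
      by rewrite inE (vfI _ _ _ hv h1) (vfI _ _ _ hv h2).
    by rewrite h0 inE.
  - by move: (C _ h1 h2); rewrite h0 inE.
  - by move: (C _ h1 h2) (C _ h3 h4); rewrite hd !inE => /eqP -> /eqP ->.
have span (f g : facet K) (v w : vert K) : f != g -> v != w ->
    vf v f -> vf v g -> vf w f -> vf w g ->
    exists e, [/\ ends e = [set v; w], ef e f & ef e g].
  move=> fg vw h1 h2 h3 h4.
  have hv : v \in common_verts f g by rewrite inE h1.
  have hw : w \in common_verts f g by rewrite inE h3.
  case: (PH f g fg) => [h0|[[x h0] _]|[d [hd hs]]].
  - by rewrite h0 inE in hv.
  - by move: hv hw vw; rewrite h0 !inE => /eqP -> /eqP ->; rewrite eqxx.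
  have : d \in sides f :&: sides g by rewrite hs set11.
  rewrite !inE => /andP [df dg]; exists d; split=> //.
  apply/esym/eqP; rewrite eqEcard cards2 vw (edge_ends R) leqnn andbT.
  by rewrite -hd; apply/subsetP=> x; rewrite in_set2 => /orP [] /eqP ->.
have pairE (e : edge K) (f : facet K) : ef e f ->
    exists2 g, f != g & [set h | ef e h] = [set f; g].
  move=> ef_; have /eqP := edge_ends R' e; rewrite /ends /= => /cards2P [a [b [ab h]]].
  have : f \in [set a; b] by rewrite -h inE.
  rewrite !inE => /orP [] /eqP ->; first by exists b.
  by exists a; rewrite 1?eq_sym // setUC.
split.
  split=> //=.
  - by rewrite /dual; case: (K) R.
  - have /card_gt0P [v _] := NE; have [e _] := vnf v.
    have /card_gt0P [f _] : 0 < #|@ends (dual K) e| by rewrite (edge_ends R').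
    by apply/card_gt0P; exists f.
  - have link (v : vert K) (f g : facet K) : vf v f -> vf v g ->
        connect (@EG (dual K)) f g.
      case/existsP=> e /andP [ve1 ef1] /existsP [e' /andP [ve2 ef2]].
      have := @facet_connected _ R' v e e'; rewrite !inE /= => /(_ ve1 ve2).
      case/connectP=> p; elim: p e f ve1 ef1 => [|x p IH] e f ve1 ef1 /=.
        move=> _ eq; have [->|fg] := eqVneq f g; first exact: connect0.
        apply: connect1; rewrite /EG /= fg; apply/existsP; exists e.
        by rewrite ef1 -eq ef2.
      case/andP=> /and3P [_ vx /existsP [h /andP [eh xh]]] hp hl.
      apply: (connect_trans _ (IH x h vx xh hp hl)).
      have [->|fh] := eqVneq f h; first exact: connect0.
      by apply: connect1; rewrite /EG /= fh; apply/existsP; exists e; rewrite ef1.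
    have somev (f : facet K) : exists v, vf v f.
      have /set0Pn [e] := facet_sides R f; rewrite inE => he.
      have /card_gt0P [v] : 0 < #|ends e| by rewrite (edge_ends R).
      by rewrite inE => hv; exists v; apply: vfI hv he.
    move=> f g; have [v vf1] := somev f; have [w wg] := somev g.
    case/connectP: (CN v w) => p; elim: p v f vf1 => [|x p IH] v f vf1 /=.
      by move=> _ eq; rewrite eq in wg; apply: link vf1 wg.
    case/andP=> /andP [_ /existsP [e /andP [hv hx]]] hp hl.
    have /card_gt0P [h] : 0 < #|@ends (dual K) e| by rewrite (edge_ends R').
    rewrite inE /= => eh.
    exact: (connect_trans (link v f h vf1 (vfI _ _ _ hv eh))
              (IH x h (vfI _ _ _ hx eh) hp hl)).
  - move=> e e' /setP hee'.
    have /card_gt0P [f] : 0 < #|@ends (dual K) e| by rewrite (edge_ends R').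
    rewrite inE /= => he; have [g fg hg] := pairE e f he.
    have : g \in [set h | ef e h] by rewrite hg !inE eqxx orbT.
    rewrite inE => heg; move: (hee' f) (hee' g); rewrite !inE /= he heg.
    by move=> /esym h1 /esym h2; apply: (uniqE f g).
  - move=> v; rewrite ltnNge; apply/negP=> small.
    have [e he] := vnf v.
    have /card_gt0P [f] : 0 < #|@ends (dual K) e| by rewrite (edge_ends R').
    rewrite inE /= => ef1; have [g fg hg] := pairE e f ef1.
    have eg1 : ef e g.
      by have : g \in [set h | ef e h]; [rewrite hg !inE eqxx orbT | rewrite inE].
    have all2 h : ef e h -> [set x | ve v x && ef x h] = @sides (dual K) v.
      move=> eh; apply/eqP; rewrite eqEcard; apply/andP; split.
        by apply/subsetP=> x; rewrite !inE => /andP [].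
      by rewrite (facet_two R (vfI _ _ _ he eh)).
    have /eqP := facet_two R (vfI _ _ _ he ef1).
    case/cards2P=> a [b [ab hab]].
    have inab x : x \in [set a; b] -> ef x f && ef x g.
      move=> hx; apply/andP; split.
        by move: hx; rewrite -hab inE => /andP [].
      by move: hx; rewrite -hab (all2 f ef1) -(all2 g eg1) inE => /andP [].
    have /andP [af ag] : ef a f && ef a g by apply: inab; rewrite !inE eqxx.
    have /andP [bf bg] : ef b f && ef b g by apply: inab; rewrite !inE eqxx orbT.
    by have eqab := uniqE f g a b fg af ag bf bg; rewrite eqab eqxx in ab.
move=> v w /= vw.
have cE (f : facet K) : (f \in @common_verts (dual K) v w) = vf v f && vf w f.
  by rewrite inE !vf_dual.
have [->|/set0Pn [f hf]] := eqVneq (@common_verts (dual K) v w) set0.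
  by constructor 1.
have := hf; rewrite cE => /andP [vf1 wf1].
have [h1|hn1] := eqVneq (@common_verts (dual K) v w) [set f].
  constructor 2; split; first by exists f.
  apply/setP=> e; rewrite !inE /=; apply/negP=> /andP [hv hw].
  have /eqP := edge_ends R' e; rewrite /ends => /cards2P [a [b [ab h]]].
  have F x : x \in [set a; b] -> x = f.
    rewrite -h inE /= => hx; apply/set1P; rewrite -h1 cE.
    by rewrite (vfI _ _ _ hv hx) (vfI _ _ _ hw hx).
  have Fa : a = f by apply: F; rewrite set21.
  have Fb : b = f by apply: F; rewrite set22.
  by rewrite Fa Fb eqxx in ab.
have [g hg fg] : exists2 g, g \in @common_verts (dual K) v w & f != g.
  apply/exists_inP; apply: contraR hn1; rewrite negb_exists_in => /forall_inP H.
  apply/eqP/setP=> g; rewrite in_set1; apply/idP/eqP => [/H|-> //].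
  by rewrite negbK => /eqP.
have := hg; rewrite cE => /andP [vg wg].
have [e [he ef1 eg1]] := span f g v w fg vw vf1 vg wf1 wg.
have inE2 x : (x == v) || (x == w) = ve x e.
  by move/setP/(_ x): he; rewrite !inE.
have hv : ve v e by rewrite -inE2 eqxx.
have hw : ve w e by rewrite -inE2 eqxx orbT.
constructor 3; exists e; split; apply/setP => x.
  rewrite cE inE /=; apply/andP/idP => [[vx wx]|hx]; last first.
    by rewrite (vfI _ _ _ hv hx) (vfI _ _ _ hw hx).
  have [<-//|fx] := eqVneq f x.
  have [d [hd _ dx]] := span f x v w fx vw vf1 vx wf1 wx.
  by rewrite (SI e d) // he hd.
rewrite !inE /=; apply/andP/eqP => [[vx wx]|->//].
apply: SI; apply/esym/eqP; rewrite eqEcard !(edge_ends R) leqnn andbT he.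
by apply/subsetP=> y; rewrite !inE => /orP [] /eqP ->.
Qed.

(* Combinatorial (PL) homeomorphism: the equivalence relation generated by    *)
(* isomorphism and the elementary subdivisions of edges and of facets.        *)

Definition cx_iso (P Q : cellcx) : Prop :=
  exists (iV : vert P -> vert Q) (iE : edge P -> edge Q)
         (iF : facet P -> facet Q),
    [/\ bijective iV, bijective iE, bijective iF,
        forall v e, ve (iV v) (iE e) = ve v e
      & forall e f, ef (iE e) (iF f) = ef e f].

(* The new vertex [None] cuts [e] into the edge [None], which takes the end   *)
(* [v] of [e], and the edge [Some e], which keeps the other end.              *)
Definition split_edge (P : cellcx) (e : edge P) (v : vert P) : cellcx :=
  @CellCx (option (vert P)) (option (edge P)) (facet P)
    (fun y x => match y, x with
                | Some u, Some d => ve u d && ~~ ((d == e) && (u == v))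
                | Some u, None => u == v
                | None, Some d => d == e
                | None, None => true
                end)
    (fun x g => if x is Some d then ef d g else ef e g).

(* The new edge [None] joins [u] and [v] across [f]; the sides of [f] in [B]  *)
(* go to the new facet [None], the others stay on [Some f].                   *)
Definition split_facet (P : cellcx) (f : facet P) (B : {set edge P})
    (u v : vert P) : cellcx :=
  @CellCx (vert P) (option (edge P)) (option (facet P))
    (fun y x => if x is Some d then ve y d else y \in [set u; v])
    (fun x g => match x, g with
                | Some d, Some h => ef d h && ~~ ((h == f) && (d \in B))
                | Some d, None => d \in B
                | None, Some h => h == f
                | None, None => true
                end).

Inductive pl_homeo : cellcx -> cellcx -> Prop :=
  | PLIso P Q : cx_iso P Q -> pl_homeo P Q
  | PLSplitEdge P (e : edge P) (v : vert P) :
      regular_cx P -> ve v e -> pl_homeo P (@split_edge P e v)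
  | PLSplitFacet P (f : facet P) (B : {set edge P}) (u v : vert P) :
      regular_cx P -> B \subset sides f -> regular_cx (@split_facet P f B u v) ->
      pl_homeo P (@split_facet P f B u v)
  | PLSym P Q : pl_homeo P Q -> pl_homeo Q P
  | PLTrans P Q R : pl_homeo P Q -> pl_homeo Q R -> pl_homeo P R.

Definition polygon (n : nat) : cellcx :=
  @CellCx 'I_n 'I_n unit (fun i j => (i == j) || (i == ordS j)) (fun _ _ => true).

Definition is_disk (P : cellcx) : Prop :=
  exists n, 3 <= n /\ pl_homeo (polygon n) P.

Section Subcomplex.

Variable K : cellcx.
Implicit Types (A : {set facet K}) (c : seq (vert K)).

(* The union of the closed facets in [A]. *)
Definition facets_cx A : cellcx :=
  @CellCx {v : vert K | [exists f in A, vf v f]}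
          {e : edge K | [exists f in A, ef e f]}
          {f : facet K | f \in A}
    (fun v e => ve (val v) (val e)) (fun e f => ef (val e) (val f)).

Definition boundary_edges A : {set edge K} :=
  [set e | #|[set f in A | ef e f]| == 1].

Definition cycle_edges c : {set edge K} :=
  [set e | [exists v in c, ve v e && ve (next c v) e]].

(* A closed disk in the surface whose boundary is a cycle of the edge graph   *)
(* is a union of facets.                                                      *)
Definition contractible c : Prop :=
  exists A, is_disk (facets_cx A) /\ boundary_edges A = cycle_edges c.

End Subcomplex.

(* [n] is the number of vertices of the map whose dual is [M]. *)
Record proper_tree (n : nat) (M : cellcx) (S : {set vert M}) (t : rel (vert M)) :
    Prop := ProperTree {
  proper_is_tree : is_tree_in (@EG M) S t;
  proper_deg : \sum_(v in S) deg (@EG M) v = n + 2 * (#|S| - 1);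
  proper_joined : forall (F : facet M) (u1 u2 : vert M),
    u1 \in S -> u2 \in S -> vf u1 F -> vf u2 F ->
    exists p, [/\ simple_path (bdry F) u1 p, last u1 p = u2 & path t u1 p];
  proper_short : forall (F : facet M) (u : vert M) (p : seq (vert M)),
    u \in S -> vf u F -> simple_path t u p -> path (bdry F) u p ->
    size p + 2 <= #|sides F|
}.

(* Main.v *)
Require Import Defs.
From mathcomp Require Import all_boot zify.

(* A contractible Hamiltonian cycle bounds a disk [A] that is a union of      *)
(* facets; the tree consists of the facets in [A], joined across their shared *)
(* edges.  The facets of a disk are connected by adjacency and a disk has     *)
(* Euler characteristic 1; as all vertices and exactly [n] edges lie on the   *)
(* boundary, there are [#|A| - 1] shared edges.  Hence the graph is a tree    *)
(* with the prescribed degree sum.  At each vertex only two edges belong to   *)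
(* the boundary, so the facets of [A] there form a proper arc of the link.    *)
(*                                                                            *)
(* Conversely, conditions (2) and (3) force a proper tree to contain every    *)
(* adjacency between its facets.  Merging adjacent facets one pair at a time, *)
(* which undoes a subdivision, turns their union into a polygon through all   *)
(* its vertices whose sides are the unshared edges: the union is a disk       *)
(* bounded by a cycle.  By Euler's formula and condition (1) this disk has    *)
(* [n] vertices, so the cycle is Hamiltonian.                                 *)

Set Implicit Arguments.
Unset Strict Implicit.
Unset Printing Implicit Defensive.

(** For a set [S] of facets, let [b] and [i] be the numbers of edges lying on exactly one and
    exactly two facets of [S]. Since two facets share at most one edge, the degrees in the dual
    graph sum to [b + 2 * i] over [S] ([sum_deg_dual]). If the union of [S] is a disk whose [V]
    vertices all lie on its boundary cycle, then [b = V], and Euler's formula ([disk_euler]) leaves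
    [i = #|S| - 1]. For such a disk, condition (1) thus amounts to [V = n], that is, to the boundary
    cycle being Hamiltonian. It remains to relate the other conditions to disks of this kind.

    From tree to disk: by (2) and (3) the tree is an induced subgraph of the dual graph
    ([proper_tree_induced]), so the union is a [tree_cx]: every shared edge is a bridge between its
    facets, and the facets at a vertex are linked around it ([proper_tree_cx]). Two facets sharing
    an edge then meet only in that edge, so merging them preserves these properties ([merge_tree]),
    the vertices and the boundary. Repeated merging ends in a polygon ([tree_cx_disk]).

    From disk to tree: only two invariants of subdivision are needed, the Euler characteristic and
    the connectedness of the facets. They yield a connected graph with [#|A| - 1] shared edges,
    hence a tree ([disk_tree_acyclic]). As only two boundary edges meet at a vertex, a parity count
    shows that the facets of [A] there hang together ([disk_tree_joined]), which is (2); the facet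
    beyond a boundary edge gives (3) ([disk_proper_tree]). *)

(** * Double counting and parity *)

Lemma sum_card_swap (X Y : finType) (C : {set X}) (D : {set Y})
    (R : X -> Y -> bool) :
  \sum_(x in C) #|[set y in D | R x y]| = \sum_(y in D) #|[set x in C | R x y]|.
Proof.
under eq_bigr do rewrite -sum1dep_card.
rewrite (exchange_big_dep (mem D)) /=; last by move=> x y _ /andP [].
apply: eq_bigr => y yD; rewrite -sum1dep_card.
by apply: eq_bigl => x; rewrite yD.
Qed.

(** The number of incidences is even, and modulo 2 only the [y] incident to exactly one [x]
    contribute to it. This replaces the fact that a path has two ends in both arguments about
    arcs. *)
Lemma even_card_once (X Y : finType) (C : {set X}) (R : X -> Y -> bool) :
  (forall x, x \in C -> #|[set y | R x y]| = 2) ->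
  (forall y, #|[set x in C | R x y]| <= 2) ->
  ~~ odd #|[set y | #|[set x in C | R x y]| == 1]|.
Proof.
move=> C2 le2.
have := sum_card_swap C [set: Y] R.
have -> : \sum_(x in C) #|[set y in [set: Y] | R x y]| = \sum_(x in C) 2.
  by apply: eq_bigr => x /C2 <-; apply: eq_card => y; rewrite !inE.
rewrite sum_nat_const => sumE.
have := congr1 odd sumE; rewrite muln2 odd_double -sum1dep_card.
rewrite !(big_morph odd (id1 := false) (op1 := addb) oddD) //.
move=> /esym H; apply/negbT; rewrite -[RHS]H big_mkcond /=.
apply: eq_big => [y|y _]; first by rewrite inE.
by have := le2 y; case: #|_| => [|[|[]]].
Qed.

(** * Connectedness, and the number of edges of a connected graph *)

Section Connect.

Variables (T : finType) (r : rel T).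

Lemma connect_exit (U : {pred T}) x y :
  connect r x y -> x \in U -> y \notin U ->
  exists a b, [/\ r a b, a \in U & b \notin U].
Proof.
case/connectP=> p; elim: p x => [|z p IH] x /= => [_ -> ->//|].
case/andP=> rxz rp lp xU yU; have [zU|zU] := boolP (z \in U); first exact: (IH z).
by exists x, z.
Qed.

Lemma connect_stay (U : {pred T}) x y :
  (forall a b, r a b -> a \in U -> b \in U) -> connect r x y -> x \in U -> y \in U.
Proof.
move=> stay rxy xU; apply/negPn/negP=> yU.
by have [a [b [rab aU]]] := connect_exit rxy xU yU; rewrite (stay a b).
Qed.

Lemma connect_map (T' : finType) (r' : rel T') (h : T -> T') :
  (forall x y, r x y -> connect r' (h x) (h y)) ->
  forall x y, connect r x y -> connect r' (h x) (h y).
Proof.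
move=> hr x y rxy; have := @connect_stay [pred z | connect r' (h x) (h z)] x y.
apply=> // [a b rab|]; rewrite !inE // => xa; exact: connect_trans xa (hr _ _ rab).
Qed.

End Connect.

(** Growing a vertex set from [x0], each new vertex is reached by an edge not counted before. The
    edges are an indexed family of sets, so that edges of [K] can serve as edges of the dual
    graph. *)
Lemma card_connected_le (T E : finType) (en : E -> {set T}) (S : {set T})
    (D : {set E}) :
  (forall d, d \in D -> #|en d| <= 2) ->
  {in S &, forall x y,
    connect [rel a b | [exists d in D, (a \in en d) && (b \in en d)]] x y} ->
  #|S| <= #|D| + 1.
Proof.
move=> en2 conn.
have [->|/set0Pn [x0 x0S]] := eqVneq S set0; first by rewrite cards0.
have grow k : k < #|S| -> exists2 U : {set T}, x0 \in U /\ #|U| = k.+1 &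
    k <= #|[set d in D | en d \subset U]|.
  elim: k => [_|k IH kS]; first by exists [set x0]; rewrite // set11 cards1.
  have [U [x0U cU] kU] := IH (ltnW kS).
  have /subsetPn [y yS yU] : ~~ (S \subset U).
    by apply/negP=> /subset_leq_card; rewrite cU leqNgt kS.
  have [a [b [/exists_inP [d dD /andP [ad bd]] aU bU]]] :=
    connect_exit (conn _ _ x0S yS) x0U yU.
  have ab : a != b by apply: contraNneq bU => <-.
  have enE : en d = [set a; b].
    apply/esym/eqP; rewrite eqEcard cards2 ab en2 // andbT.
    by apply/subsetP=> z /set2P [] ->.
  exists (b |: U); first by rewrite !inE x0U orbT cardsU1 bU cU.
  apply: (leq_ltn_trans kU); apply: proper_card; apply/properP; split.
    apply/subsetP=> z; rewrite !inE => /andP [-> /subset_trans]; apply.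
    exact: subsetUr.
  exists d; rewrite inE dD enE; last first.
    by apply/negP=> /subsetP /(_ b); rewrite set22 (negbTE bU) => /(_ isT).
  by apply/subsetP=> z /set2P [] ->; rewrite !inE ?eqxx // aU orbT.
have cS : 0 < #|S| by apply/card_gt0P; exists x0.
have [|U _ le] := grow #|S|.-1; first by rewrite prednK.
rewrite addn1 -(prednK cS) ltnS (leq_trans le) // subset_leq_card //.
by apply/subsetP=> d; rewrite inE => /andP [].
Qed.

(** * Cycles in graphs of maximum degree two *)

Section Cycles.

Variables (T : finType) (r : rel T).
Implicit Types (c p : seq T) (x y : T).

Lemma next_next_neq c x : 2 < size c -> uniq c -> x \in c -> next c (next c x) != x.
Proof.
move=> sc uc xc; have [i p cE] := rot_to xc.
rewrite -!(next_rot i uc) cE.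
have : uniq (x :: p) by rewrite -cE rot_uniq.
have : 2 < size (x :: p) by rewrite -cE size_rot.
case: p {cE} => [|y [|z p]] //= _; rewrite !inE !negb_or eqxx.
case/and3P=> /and3P [xy xz _] _ _.
by rewrite [y == x]eq_sym (negbTE xy) eqxx eq_sym.
Qed.

Lemma next_neq_prev c x : 2 < size c -> uniq c -> x \in c -> next c x != prev c x.
Proof.
move=> sc uc xc; apply: contra_neq (next_next_neq sc uc xc) => ->.
exact: next_prev.
Qed.

Hypothesis r_sym : symmetric r.

Lemma cycle_neighbours c x y :
  is_cycle r c -> x \in c -> deg r x <= 2 -> r x y -> y = next c x \/ y = prev c x.
Proof.
case/andP=> sc /andP [cc uc] xc dx rxy.
have ne := next_neq_prev sc uc xc.
have : [set next c x; prev c x] == [set z | r x z].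
  rewrite eqEcard cards2 ne dx andbT; apply/subsetP=> z /set2P [] ->.
    by rewrite inE next_cycle.
  by rewrite inE r_sym prev_cycle.
by move/eqP/setP/(_ y); rewrite !inE rxy => /orP [] /eqP; [left|right].
Qed.

(** Leaving the cycle would take a third neighbour of one of its vertices. *)
Lemma cycle_covers c x y :
  is_cycle r c -> (forall z, deg r z <= 2) -> x \in c -> connect r x y -> y \in c.
Proof.
move=> cc d2 xc rxy; apply: (connect_stay _ rxy xc) => a b rab ac.
by case: (cycle_neighbours cc ac (d2 a) rab) => ->; rewrite ?mem_next ?mem_prev.
Qed.

Hypothesis r_irr : irreflexive r.

Lemma two_regular_cycle (x0 : T) : (forall x, deg r x = 2) -> exists c, is_cycle r c.
Proof.
move=> d2.
(* A simple path is extended at its head [x] for as long as possible; [n] bounds the number of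
   extensions left. *)
suff H n x y p : #|T| - size p < n -> path r x (y :: p) -> uniq [:: x, y & p] ->
    exists c, is_cycle r c.
  have /card_gt0P [y] : 0 < #|[set y | r x0 y]| by rewrite [#|_|]d2.
  rewrite inE => rxy; apply: (H _ x0 y [::] (ltnSn _)); rewrite /= ?rxy //.
  by rewrite inE andbT; apply: contraTneq rxy => ->; rewrite r_irr.
elim: n x y p => // n IH x y p ltn rp up.
have [z rxz zy] : exists2 z, r x z & z != y.
  have /cards2P [a [b [ab dE]]] : #|[set z | r x z]| == 2 by rewrite [#|_|]d2.
  have H z : (z == a) || (z == b) = r x z by move/setP/(_ z): dE; rewrite !inE.
  have [ay|ay] := eqVneq a y; last by exists a; rewrite // -H eqxx.
  by exists b; rewrite -?H ?eqxx ?orbT // -ay eq_sym.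
have [zs|zs] := boolP (z \in [:: x, y & p]); last first.
  have := max_card [in [:: x, y & p]]; rewrite (card_uniqP up) /= => sp.
  apply: (IH z x (y :: p)); first by move: sp ltn => /=; lia.
    by rewrite /= r_sym rxz.
  by rewrite cons_uniq zs.
have zx : z != x by apply: contraTneq rxz => ->; rewrite r_irr.
move: zs; rewrite !inE (negbTE zx) (negbTE zy) /= => zp.
case/splitPr: zp rp up {ltn} => p1 [|w p2] rp up.
  exists [:: x, y & rcons p1 z]; rewrite /is_cycle /= size_rcons /=.
  rewrite /ucycleb -cats1 up andbT /= rcons_path last_cat /= [r z x]r_sym rxz andbT.
  by move: rp => /=.
(* Here the path returns to an interior vertex [z], which would have three neighbours: [x] and its
   two path neighbours [l] and [w]. *)
have rzw : r z w by move: rp; rewrite /= cat_path /= => /and5P [].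
set l := last y p1.
have rzl : r z l by rewrite r_sym; move: rp; rewrite /= cat_path => /and4P [].
have : uniq ((x :: y :: p1) ++ z :: w :: p2) by [].
rewrite cat_uniq => /and3P [u1 /hasPn disj u2].
have lin : l \in y :: p1 by rewrite mem_last.
have xl : x != l by apply: contraTneq u1 => ->; rewrite /= lin.
have wn : w \notin x :: y :: p1 by apply: disj; rewrite !inE eqxx orbT.
have xw : x != w by apply: contraNneq wn => ->; rewrite inE eqxx.
have lw : l != w by apply: contraNneq wn => <-; rewrite inE lin orbT.
have : #|[set x; l; w]| <= #|[set u | r z u]|.
  apply: subset_leq_card; apply/subsetP=> u; rewrite !inE -orbA.
  by case/or3P=> /eqP -> //; rewrite r_sym.
by rewrite [#|[set u | _]|]d2 setUC cardsU1 cards2 !inE xl eq_sym (negbTE xw) eq_sym (negbTE lw).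
Qed.

Lemma two_regular_hamiltonian (x0 : T) :
  (forall x, deg r x = 2) -> (forall x y, connect r x y) ->
  exists c, hamiltonian_cycle r c.
Proof.
move=> d2 conn; have [c cc] := two_regular_cycle x0 d2; exists c; split=> // x.
have [y yc] : exists y, y \in c by case: c cc => // y c _; exists y; rewrite mem_head.
by apply: (cycle_covers cc _ yc (conn y x)) => z; rewrite d2.
Qed.

End Cycles.

(** * Incidence in regular complexes *)

Section Incidence.

Variable P : cellcx.
Hypotheses (R : regular_cx P) (SI : injective (@ends P)).
Implicit Types (u v w : vert P) (d e : edge P) (f g h : facet P).

Lemma vfI v e f : ve v e -> ef e f -> vf v f.
Proof. by move=> hv hf; apply/existsP; exists e; rewrite hv. Qed.

Lemma ends_pair u v e : u != v -> ve u e -> ve v e -> ends e = [set u; v].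
Proof.
move=> uv hu hv; apply/esym/eqP; rewrite eqEcard cards2 uv (edge_ends R) andbT.
by apply/subsetP=> z /set2P [] ->; rewrite inE.
Qed.

Lemma edge_unique u v d e :
  u != v -> ve u d -> ve v d -> ve u e -> ve v e -> d = e.
Proof. by move=> uv *; apply: SI; rewrite !(ends_pair uv). Qed.

Lemma other_end v e : ve v e -> exists w, [/\ v != w, ve w e & ends e = [set v; w]].
Proof.
move=> hv; have /cards2P [a [b [ab enE]]] : #|ends e| == 2 by rewrite (edge_ends R).
have [ha hb] : ve a e /\ ve b e.
  by move/setP: enE => E; have := E a; have := E b; rewrite !inE !eqxx orbT.
have : v \in ends e by rewrite inE.
rewrite enE => /set2P [] ->; first by exists b.
by exists a; rewrite eq_sym setUC.
Qed.

Lemma other_side v e f : ve v e -> ef e f ->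
  exists d, [/\ d != e, ve v d & ef d f].
Proof.
move=> hv hf; have := facet_two R (vfI hv hf).
set X := [set _ | _] => X2.
have /set0Pn [d] : X :\ e != set0.
  by rewrite -card_gt0; have := cardsD1 e X; rewrite X2 inE hv hf; lia.
by rewrite !inE => /and3P [? ? ?]; exists d.
Qed.

(** Without parallel edges, sending an edge at [v] to its other end is injective. Taking [D] trivial
    gives degrees in [EG]; taking the sides of a facet gives degrees in its boundary. *)
Lemma card_neighbours (D : pred (edge P)) v :
  #|[set w | (v != w) && [exists e, [&& ve v e, ve w e & D e]]]| =
  #|[set e | ve v e && D e]|.
Proof.
pose other e := odflt v [pick w | (v != w) && ve w e].
have otherP e : ve v e -> v != other e /\ ve (other e) e.
  move=> hv; rewrite /other; case: pickP => [w /andP []//|no].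
  by have [w [vw hw _]] := other_end hv; have := no w; rewrite vw hw.
rewrite -[RHS](@card_in_imset _ _ other).
  apply: eq_card => w; rewrite inE; apply/andP/imsetP.
    case=> vw /existsP [e /and3P [hv hw hD]]; exists e; first by rewrite inE hv.
    have [vo ho] := otherP e hv.
    have : other e \in ends e by rewrite inE.
    by rewrite (ends_pair vw hv hw) !inE eq_sym (negbTE vo) => /eqP.
  case=> e; rewrite inE => /andP [hv hD] ->; have [vo ho] := otherP e hv.
  by split=> //; apply/existsP; exists e; rewrite hv ho.
move=> d e; rewrite !inE => /andP [dv _] /andP [hv _] oE.
have [vo ho] := otherP _ dv; have [_ he] := otherP _ hv.
by apply: (edge_unique vo) => //; rewrite oE.
Qed.

Lemma deg_EG v : deg (@EG P) v = #|[set e | ve v e]|.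
Proof.
transitivity #|[set e | ve v e && predT e]|.
  rewrite -card_neighbours; apply: eq_card => w; rewrite !inE.
  by congr (_ && _); apply: eq_existsb => e; rewrite andbT.
by apply: eq_card => e; rewrite !inE andbT.
Qed.

Lemma deg_bdry_le f v : deg (bdry f) v <= 2.
Proof.
rewrite (_ : deg _ _ = #|[set e | ve v e && ef e f]|); last exact: card_neighbours.
have [/(facet_two R) -> //|nvf] := boolP (vf v f).
rewrite eq_card0 // => e; rewrite !inE.
by apply: contraNF nvf => /andP [hv hf]; apply: vfI hv hf.
Qed.

Lemma bdry_sym f : symmetric (bdry f).
Proof.
move=> u v; rewrite /bdry /= eq_sym; congr (_ && _).
by apply: eq_existsb => e; rewrite andbCA.
Qed.

Lemma EG_sym : symmetric (@EG P).
Proof.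
move=> u v; rewrite /EG /= eq_sym; congr (_ && _).
by apply: eq_existsb => e; rewrite andbC.
Qed.

Lemma EG_irr : irreflexive (@EG P).
Proof. by move=> u; rewrite /EG /= eqxx. Qed.

(** Each vertex is on two sides and each side has two ends. In the dual, this identifies the face
    length of condition (3) with the number of facets around a vertex. *)
Lemma card_verts_facet f : #|[set v | vf v f]| = #|sides f|.
Proof.
have := sum_card_swap [set v | vf v f] (sides f) (@ve P).
rewrite (eq_bigr (fun=> 2)); last first.
  move=> v; rewrite inE => /(facet_two R) <-.
  by apply: eq_card => e; rewrite !inE andbC.
rewrite [RHS](eq_bigr (fun=> 2)); last first.
  move=> e; rewrite inE => hf; rewrite -(edge_ends R e).
  apply: eq_card => v; rewrite !inE; apply: andb_idl => hv; exact: vfI hv hf.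
by rewrite !sum_nat_const; lia.
Qed.

Lemma bdry_connect f u v : vf u f -> vf v f -> connect (bdry f) u v.
Proof.
have same e a b : ef e f -> ve a e -> ve b e -> connect (bdry f) a b.
  move=> hf ha hb; have [->//|ab] := eqVneq a b.
  by apply: connect1; rewrite /bdry /= ab; apply/existsP; exists e; rewrite ha hb.
case/existsP=> d /andP [ud df] /existsP [e /andP [hv hf]].
have conn := @facet_connected _ R f d e; rewrite !inE in conn.
have {conn} := conn df hf; case/connectP=> p.
elim: p d u ud df => [|x p IH] d u ud df /=.
  by move=> _ eE; rewrite eE in hv; apply: same df ud hv.
case/andP=> /and3P [_ xf /existsP [w /andP [wd wx]]] rp lp.
by apply: connect_trans (same d u w df ud wd) (IH x w wx xf rp lp).
Qed.

(* Parity: a component of the sides of [f] other than [e] has an even number  *)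
(* of dead ends, and these are ends of [e]; so it reaches both ends of [e].   *)
Lemma sides_minus_connected f e x y : ef e f ->
  x != e -> ef x f -> y != e -> ef y f ->
  connect [rel a b | [&& (a != e) && ef a f, (b != e) && ef b f &
             [exists v, ve v a && ve v b]]] x y.
Proof.
move=> hf xe xf ye yf; set r := (X in connect X).
have r_sym : connect_sym r.
  apply: sym_connect_sym => a b; rewrite /r /= andbCA; congr [&& _, _ & _].
  by apply: eq_existsb => v; rewrite andbC.
pose C a := [set b | connect r a b].
have CP a b : (a != e) && ef a f -> b \in C a -> (b != e) && ef b f.
  move=> ha; rewrite inE => rab.
  apply: (@connect_stay _ _ [pred z | (z != e) && ef z f] _ _ _ rab ha).
  by move=> z w /and3P [].
have near a b c v : (a != e) && ef a f -> b \in C a -> ve v b -> ve v c ->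
    c != e -> ef c f -> c \in C a.
  move=> ha hb vb vc ce cf; move: (hb); rewrite !inE => rab.
  apply: connect_trans rab (connect1 _); rewrite /r /= ce cf (CP a) //=.
  by apply/existsP; exists v; rewrite vb vc.
have reach a v : (a != e) && ef a f -> ve v e -> exists2 b, b \in C a & ve v b.
  move=> ha hv.
  pose L := [set v | #|[set b in C a | ve v b]| == 1].
  have le2 w : #|[set b in C a | ve w b]| <= 2.
    have [/eqP->//|/set0Pn [b]] := boolP ([set b in C a | ve w b] == set0).
      by rewrite cards0.
    case/setIdP=> /(CP _ _ ha) /andP [_ bf] wb.
    rewrite -(facet_two R (vfI wb bf)); apply: subset_leq_card.
    by apply/subsetP=> d /setIdP [/(CP _ _ ha)/andP [_ df] wd]; rewrite inE wd.
  have evL : ~~ odd #|L|.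
    by apply: even_card_once le2 => b _; exact: (edge_ends R b).
  have Lsub : L \subset ends e.
    apply/subsetP=> w; rewrite !inE => /cards1P [b bE].
    have /setIdP [bC wb] : b \in [set b in C a | ve w b] by rewrite bE set11.
    have /andP [be bf] := CP _ _ ha bC.
    have [d [db wd df]] := other_side wb bf.
    have [<-//|de] := eqVneq d e.
    have : d \in [set b in C a | ve w b] by rewrite inE wd (near a b d w).
    by rewrite bE inE (negbTE db).
  (* All sides of [f] together are connected, so one can leave the component of [a], and only into
     [e]; the vertex where this happens is a dead end. *)
  have L0 : L != set0.
    have aC : a \in C a by rewrite inE connect0.
    have eC : e \notin C a by apply/negP=> /(CP _ _ ha); rewrite eqxx.
    have /andP [ae af] := ha.
    have conn := @facet_connected _ R f a e; rewrite !inE in conn.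
    have [b [d [/and3P [bf df /existsP [w /andP [wb wd]]] bC dC]]] :=
      connect_exit (conn af hf) aC eC.
    have dE : d = e by apply: contraNeq dC => de; apply: (near a b d w).
    apply/set0Pn; exists w; rewrite inE eqn_leq -[_ <= 1]ltnS andbC.
    apply/andP; split; first by apply/card_gt0P; exists b; rewrite inE bC.
    rewrite -(facet_two R (vfI wd df)); apply: proper_card; apply/properP; split.
      by apply/subsetP=> z /setIdP [/(CP _ _ ha)/andP [_ zf] wz]; rewrite inE wz.
    by exists d; [rewrite inE wd | apply/negP=> /setIdP []; rewrite (negbTE dC)].
  have LE : L = ends e.
    apply/eqP; rewrite eqEcard Lsub (edge_ends R).
    by rewrite -card_gt0 in L0; case: #|L| L0 evL => [|[]].
  have : v \in L by rewrite LE inE.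
  rewrite inE => /cards1P [b bE].
  have /setIdP [bC vb] : b \in [set b in C a | ve v b] by rewrite bE set11.
  by exists b.
have /card_gt0P [v] : 0 < #|ends e| by rewrite (edge_ends R).
rewrite inE => hv.
have hx : (x != e) && ef x f by rewrite xe.
have hy : (y != e) && ef y f by rewrite ye.
have [a aC va] := reach x v hx hv; have [b bC vb] := reach y v hy hv.
have /andP [be bf] := CP _ _ hy bC.
have := near x a b v hx aC va vb be bf; rewrite inE => xb.
by apply: connect_trans xb _; rewrite r_sym; move: bC; rewrite inE.
Qed.

End Incidence.

(** * Invariants of subdivision, and merging facets *)

(** [D] selects the edges that may be crossed: all of them for connectedness, all but one for
    bridges, those at a vertex for links. *)
Definition facet_adj (P : cellcx) (D : pred (edge P)) : rel (facet P) :=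
  [rel f g | [exists e, [&& D e, ef e f & ef e g]]].

Lemma facet_adjI (P : cellcx) (D : pred (edge P)) e (f g : facet P) :
  D e -> ef e f -> ef e g -> facet_adj D f g.
Proof. by move=> De hf hg; apply/existsP; exists e; rewrite De hf. Qed.

Lemma facet_adj_sym (P : cellcx) (D : pred (edge P)) : connect_sym (facet_adj D).
Proof.
apply: sym_connect_sym => f g; apply: eq_existsb => e.
by rewrite [ef e f && _]andbC.
Qed.

Lemma cx_iso_sym (P Q : cellcx) : cx_iso P Q -> cx_iso Q P.
Proof.
case=> iV [iE [iF [[jV VK KV] [jE EK KE] [jF FK KF] hve hef]]].
exists jV, jE, jF; split; [by exists iV | by exists iE | by exists iF | |].
- by move=> v e; rewrite -[in RHS](KV v) -[in RHS](KE e) hve.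
- by move=> e f; rewrite -[in RHS](KE e) -[in RHS](KF f) hef.
Qed.

Lemma cx_iso_regular (P Q : cellcx) : cx_iso P Q -> regular_cx P -> regular_cx Q.
Proof.
case=> iV [iE [iF [[jV VK KV] [jE EK KE] [jF FK KF] hve hef]]] R.
have qve v e : ve v e = ve (jV v) (jE e) by rewrite -hve KV KE.
have qef e f : ef e f = ef (jE e) (jF f) by rewrite -hef KE KF.
have qvf v f : vf v f = vf (jV v) (jF f).
  apply/existsP/existsP=> -[e]; first by rewrite qve qef; exists (jE e).
  by move=> H; exists (iE e); rewrite qve qef EK.
split.
- move=> e; rewrite -(edge_ends R (jE e)) -(card_imset _ (can_inj VK)).
  apply: eq_card => v; rewrite -[v]KV mem_imset ?inE ?qve ?VK //.
  exact: can_inj VK.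
- move=> f; have /set0Pn [e] := facet_sides R (jF f); rewrite inE => he.
  by apply/set0Pn; exists (iE e); rewrite inE qef EK.
- move=> v f; rewrite qvf => /(facet_two R) <-; rewrite -(card_imset _ (can_inj EK)).
  apply: eq_card => e; rewrite -[e]KE mem_imset ?inE ?qve ?qef ?EK //.
  exact: can_inj EK.
- move=> f d e; rewrite !inE !qef => df hf.
  have conn := @facet_connected _ R (jF f) (jE d) (jE e); rewrite !inE in conn.
  rewrite -[d]KE -[e]KE; apply: connect_map (conn df hf) => a b /and3P [af bf].
  case/existsP=> v /andP [va vb]; apply: connect1; rewrite /= !qef !EK af bf /=.
  by apply/existsP; exists (iV v); rewrite !hve va.
Qed.

(** Invariance of the Euler characteristic, rearranged to avoid subtraction: each subdivision adds
    an edge together with a vertex or a facet. *)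
Lemma pl_homeo_euler (P Q : cellcx) : pl_homeo P Q ->
  #|vert P| + #|facet P| + #|edge Q| = #|vert Q| + #|facet Q| + #|edge P|.
Proof.
elim=> {P Q} [P Q|P e v _ _|P f B u v _ _ _|P Q _ ->//|P Q R _ IH1 _ IH2].
- case=> iV [iE [iF [bV bE bF _ _]]].
  by rewrite (bij_eq_card bV) (bij_eq_card bE) (bij_eq_card bF).
- by rewrite /= !card_option addnS !addSn.
- by rewrite /= !card_option !addnS addSn.
- lia.
Qed.

Definition facet_connected_cx (P : cellcx) : Prop :=
  forall f g : facet P, connect (facet_adj predT) f g.

(** Splitting an edge leaves its facets adjacent across a half of it. The two parts of a split facet
    are adjacent across the new edge, and [pi] below glues them back. *)
Lemma pl_homeo_facet_connected (P Q : cellcx) :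
  pl_homeo P Q -> facet_connected_cx P <-> facet_connected_cx Q.
Proof.
have iso P' Q' : cx_iso P' Q' -> facet_connected_cx P' -> facet_connected_cx Q'.
  case=> iV [iE [iF [_ _ [jF FK KF] _ hef]]] cP f g.
  rewrite -[f]KF -[g]KF; apply: connect_map (cP (jF f) (jF g)) => a b.
  case/existsP=> e /and3P [_ ea eb]; apply: connect1.
  by apply: (@facet_adjI _ _ (iE e)); rewrite ?hef.
elim=> {P Q} [P Q PQ|P e v _ _|P f B u v _ /subsetP Bf _|P Q _ ->//|P Q R _ -> _ ->//].
- by split; apply: iso => //; apply: cx_iso_sym.
- split=> cP f g; apply: connect_sub (cP f g) => a b /existsP [d].
    by case/andP=> _ /andP [da db]; exact/connect1/(@facet_adjI (split_edge e v) predT (Some d)).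
  case: d => [d|] /andP [_ /andP [da db]]; apply: connect1.
    exact: (@facet_adjI _ _ d).
  exact: (@facet_adjI _ _ e).
set Q := split_facet f B u v.
have fN : connect (@facet_adj Q predT) (Some f) None.
  by apply/connect1/(@facet_adjI Q predT None); rewrite //= eqxx.
split=> cP.
  have near d x : ef d x ->
      exists2 y, @ef Q (Some d) y & connect (@facet_adj Q predT) (Some x) y.
    move=> dx; have [/andP [/eqP -> dB]|nB] := boolP ((x == f) && (d \in B)).
      by exists None.
    by exists (Some x) => //=; rewrite dx.
  have S x y : connect (@facet_adj Q predT) (Some x) (Some y).
    apply: connect_map (cP x y) => a b /existsP [d /and3P [_ da db]].
    have [a' da' aa'] := near d a da; have [b' db' bb'] := near d b db.
    rewrite facet_adj_sym in bb'; apply: connect_trans aa' (connect_trans _ bb').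
    exact/connect1/(@facet_adjI Q predT (Some d)).
  case=> [x|] [y|] //; first exact: connect_trans (S x f) fN.
  by rewrite facet_adj_sym; exact: connect_trans (S y f) fN.
move=> x y.
pose pi (h : facet Q) : facet P := odflt f h.
apply: (@connect_map _ (@facet_adj Q predT) _ _ pi _ (Some x) (Some y) (cP _ _)).
have efpi d (h : facet Q) : @ef Q (Some d) h -> ef d (pi h).
  by case: h => [h /andP []|/Bf] //=; rewrite inE.
move=> a b /existsP [[d|] /and3P [_ da db]].
  by apply/connect1/(@facet_adjI _ _ d) => //; apply: efpi.
have N (h : facet Q) : @ef Q None h -> pi h = f by case: h => //= h /eqP.
by rewrite !N.
Qed.

(* [tc_connected] and [tc_bridge] say that the dual multigraph is a tree; the *)
(* bridge formulation is the one that is stable under contraction.            *)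
Record tree_cx (P : cellcx) : Prop := TreeCx {
  tc_regular : regular_cx P;
  tc_simple : injective (@ends P);
  tc_nonempty : 0 < #|facet P|;
  tc_vert : forall v : vert P, exists e, ve v e;
  tc_edge : forall e : edge P, 0 < #|[set f | ef e f]| <= 2;
  tc_connected : facet_connected_cx P;
  tc_bridge : forall e (f g : facet P), f != g -> ef e f -> ef e g ->
    ~~ connect (facet_adj (predC1 e)) f g;
  tc_link : forall v (f g : facet P), vf v f -> vf v g ->
    connect (facet_adj (ve v)) f g
}.

(* Inverse to [split_facet]: [g] is absorbed into [f] across [e]. *)
Definition merge (P : cellcx) (e : edge P) (f g : facet P) : cellcx :=
  @CellCx (vert P) {d : edge P | d != e} {h : facet P | h != g}
    (fun v d => ve v (val d))
    (fun d h => ef (val d) (val h) || (val h == f) && ef (val d) g).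

Section Merge.

Variables (P : cellcx) (e : edge P) (f g : facet P).
Hypotheses (TP : tree_cx P) (fg : f != g) (hf : ef e f) (hg : ef e g).
Let R := tc_regular TP.
Let Q := merge e f g.

Lemma shared_edge_facets h : ef e h -> h = f \/ h = g.
Proof.
move=> he; have : [set f; g] == [set h | ef e h].
  rewrite eqEcard cards2 fg; have /andP [_ ->] := tc_edge TP e; rewrite andbT.
  by apply/subsetP=> z /set2P [] ->; rewrite inE.
by move/eqP/setP/(_ h); rewrite !inE he => /orP [] /eqP; [left|right].
Qed.

Lemma shared_edge_unique d : ef d f -> ef d g -> d = e.
Proof.
move=> df dg; have := tc_bridge TP fg hf hg; apply: contraNeq => de.
exact/connect1/(@facet_adjI _ _ d).
Qed.

(** If [e] missed [v], one could pass from [f] to [g] around [v] without crossing [e], which is a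
    bridge. With [shared_edge_unique], the closed facets [f] and [g] meet exactly in the closed edge
    [e]. *)
Lemma shared_edge_common v : vf v f -> vf v g -> ve v e.
Proof.
move=> vf1 vg; have := tc_bridge TP fg hf hg; apply: contraNT => nve.
apply: connect_sub (tc_link TP vf1 vg) => a b /existsP [d /and3P [vd da db]].
apply/connect1/(@facet_adjI _ _ d) => //=.
by apply: contraNneq nve => <-.
Qed.

Definition merge_facet (h : facet P) : facet Q :=
  insubd (Sub f fg : {h : facet P | h != g}) h.

Lemma val_merge_facet h : val (merge_facet h) = if h != g then h else f.
Proof. exact: val_insubd. Qed.

Lemma merge_facetK (k : facet Q) : merge_facet (val k) = k.
Proof. by apply: val_inj; rewrite val_merge_facet (valP k). Qed.

Lemma merge_facet_inj h k : merge_facet h = merge_facet k ->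
  h = k \/ (ef e h /\ ef e k).
Proof.
move/(congr1 val); rewrite !val_merge_facet.
have [->|hg'] := eqVneq h g; have [->|kg'] := eqVneq k g => /=.
- by left.
- by move=> <-; right.
- by move=> ->; right.
- by left.
Qed.

Lemma merge_ef (d : edge Q) h : ef (val d) h -> ef d (merge_facet h).
Proof.
rewrite /Q /= val_merge_facet; have [->|] := eqVneq h g; last by move=> _ ->.
by rewrite eqxx => ->; rewrite orbT.
Qed.

(** The last clause serves to lift routes: moving within the merged facet only crosses [e], which is
    never the edge [c] of [Q] to be avoided. *)
Lemma merge_ef_lift (d : edge Q) (k : facet Q) : ef d k ->
  exists h, [/\ merge_facet h = k, ef (val d) h &
    forall c : edge Q, connect (facet_adj (predC1 (val c))) (val k) h].
Proof.
case/orP=> [dk|/andP [/eqP kf dg]]; first by exists (val k); rewrite merge_facetK.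
exists g; split=> // [|c].
  by apply: val_inj; rewrite val_merge_facet eqxx kf.
rewrite kf; apply/connect1/(@facet_adjI _ _ e) => //=.
by rewrite eq_sym (valP c).
Qed.

Lemma merge_vf (v : vert P) (k : facet Q) : @vf Q v k -> exists2 h, merge_facet h = k & vf v h.
Proof.
case/existsP=> d /andP [vd /merge_ef_lift [h [hk dh _]]].
by exists h => //; apply: (@vfI P v (val d) h).
Qed.

Lemma merge_adj (D : pred (edge P)) d a b : D d -> ef d a -> ef d b ->
  connect (@facet_adj Q (D \o val)) (merge_facet a) (merge_facet b).
Proof.
move=> Dd da db; have [de|de] := eqVneq d e; last first.
  by apply/connect1/(@facet_adjI _ _ (Sub d de : edge Q)) => //; exact: merge_ef.
rewrite de in da db; suff -> : merge_facet a = merge_facet b by [].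
apply: val_inj; rewrite !val_merge_facet.
by case: (shared_edge_facets da) (shared_edge_facets db) => -> [] ->; rewrite ?eqxx ?fg.
Qed.

Lemma merge_side (d : edge P) (k : facet Q) : val k != f -> ef d (val k) -> d != e.
Proof.
move=> kf dk; apply/eqP=> de; rewrite de in dk.
case: (shared_edge_facets dk) => E; first by rewrite E eqxx in kf.
by have := valP k; rewrite E eqxx.
Qed.

(** At an end of [e], each of [f] and [g] contributes its one side other than [e]. Any other vertex
    lies on at most one of them, by [shared_edge_common], and keeps its two sides. *)
Lemma merge_facet_two (v : vert P) (k : facet Q) :
  @vf Q v k -> #|[set d : edge Q | @ve Q v d && ef d k]| = 2.
Proof.
move=> vk.
rewrite -(card_imset _ val_inj).
have -> : val @: [set d : edge Q | @ve Q v d && ef d k] =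
    [set d | ve v d && (ef d (val k) || (val k == f) && ef d g)] :\ e.
  apply/setP=> d; apply/imsetP/idP => [[x]|].
    by rewrite inE /= => H ->; rewrite !inE (valP x).
  by rewrite !inE => /andP [de H]; exists (Sub d de); rewrite ?inE.
have [kf|kf] := eqVneq (val k) f; last first.
  have [h hk vh] := merge_vf vk.
  have hE : h = val k.
    move: hk => /(congr1 val); rewrite val_merge_facet.
    by case: eqP => // _ /esym E; rewrite E eqxx in kf.
  rewrite hE in vh; rewrite -(facet_two R vh); apply: eq_card => d.
  rewrite !inE orbF andbC -andbA; case vd: (ve v d) => //=.
  by apply: andb_idr => dk; apply: merge_side kf dk.
rewrite kf /=.
pose X h := [set d | ve v d && ef d h].
have -> : [set d | ve v d && (ef d f || ef d g)] = X f :|: X g.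
  by apply/setP=> d; rewrite !inE andb_orr.
have [hv|nv] := boolP (ve v e).
  have D h : ef e h -> #|X h :\ e| = 1.
    move=> eh; have := facet_two R (vfI hv eh); rewrite -/(X h) (cardsD1 e).
    by rewrite inE hv eh => -[].
  rewrite setDUl cardsU !D // (_ : _ :&: _ = set0) ?cards0 //.
  apply/setP=> d; rewrite !inE; apply/negP=> /andP [/and3P [de _ df] /and3P [_ _ dg]].
  by rewrite (shared_edge_unique df dg) eqxx in de.
have X0 h : ~~ vf v h -> X h = set0.
  move=> nvh; apply/setP=> d; rewrite !inE.
  by apply: contraNF nvh => /andP [vd dh]; apply: vfI vd dh.
have eX h : X h :\ e = X h.
  by apply/setP=> d; rewrite !inE; case: eqP => // ->; rewrite (negbTE nv).
have [vf1|nvf] := boolP (vf v f).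
  rewrite (X0 g) ?setU0 ?eX; first exact: (facet_two R).
  by apply: contra nv; apply: shared_edge_common.
rewrite (X0 f) // set0U eX; apply: (facet_two R).
have [h hk vh] := merge_vf vk.
move: hk => /(congr1 val); rewrite val_merge_facet kf.
by have [<-//|_ /= hE] := eqVneq h g; rewrite hE (negbTE nvf) in vh.
Qed.

Lemma merge_regular : regular_cx Q.
Proof.
split.
- by move=> d; exact: (edge_ends R (val d)).
- move=> k; apply/set0Pn.
  have [kf|kf] := eqVneq (val k) f; last first.
    have /set0Pn [d] := facet_sides R (val k); rewrite inE => dk.
    by exists (Sub d (merge_side kf dk)); rewrite inE /= dk.
  have /card_gt0P [v] : 0 < #|ends e| by rewrite (edge_ends R).
  rewrite inE => hv; have [d [de vd df]] := other_side R hv hf.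
  by exists (Sub d de); rewrite inE /= kf df.
- exact: merge_facet_two.
- move=> k d d'; rewrite !inE => dk dk'.
  set r := (X in connect X).
  have rI (v : vert P) (a b : edge Q) : ef a k -> ef b k -> @ve Q v a -> @ve Q v b -> r a b.
    by move=> ak bk va vb; apply/and3P; split=> //; apply/existsP; exists v; apply/andP.
  pose s x : edge Q := insubd d x.
  have vs x : x != e -> val (s x) = x by move=> xe; rewrite val_insubd xe.
  have sK x : s (val x) = x by apply: val_inj; rewrite vs ?(valP x).
  have sve (v : vert P) x : x != e -> @ve Q v (s x) = ve v x.
    by move=> xe; rewrite -[in RHS](vs x xe).
  have sef x : x != e -> ef (s x) k = ef x (val k) || (val k == f) && ef x g.
    by move=> xe; rewrite -[in RHS](vs x xe).
  have [kf|kf] := eqVneq (val k) f; last first.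
    have ek : @ef Q d k = ef (val d) (val k) by rewrite /= (negbTE kf) orbF.
    have ek' : @ef Q d' k = ef (val d') (val k) by rewrite /= (negbTE kf) orbF.
    have conn := @facet_connected _ R (val k) (val d) (val d').
    rewrite !inE -ek -ek' in conn; move/(@connect_map _ _ _ r s): (conn dk dk').
    rewrite !sK; apply=> a b /and3P [ak bk /existsP [v /andP [va vb]]].
    have ae := merge_side kf ak; have be := merge_side kf bk.
    by apply/connect1/(rI v); rewrite ?sef ?sve ?ak ?bk.
  (* The boundary of the merged facet consists of two arcs, the sides of [f] and of [g] without [e];
     they are joined below at an end [v] of [e]. *)
  have arc h a b : (h = f) \/ (h = g) -> a != e -> ef a h -> b != e -> ef b h ->
      connect r (s a) (s b).
    move=> hh ae ah be bh.
    have eh : ef e h by case: hh => ->.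
    apply: connect_map (sides_minus_connected R eh ae ah be bh).
    move=> x y /and3P [/andP [xe xh] /andP [ye yh] /existsP [v /andP [vx vy]]].
    apply/connect1/(rI v); rewrite ?sve ?sef // kf eqxx /=.
      by case: hh xh => -> ->; rewrite ?orbT.
    by case: hh yh => -> ->; rewrite ?orbT.
  have r_sym : connect_sym r.
    apply: sym_connect_sym => a b; rewrite /r /= andbCA; congr [&& _, _ & _].
    by apply: eq_existsb => v; rewrite andbC.
  have /card_gt0P [v] : 0 < #|ends e| by rewrite (edge_ends R).
  rewrite inE => hv.
  have [a [ae va af]] := other_side R hv hf; have [b [be vb bg]] := other_side R hv hg.
  have toa (x : edge Q) : ef x k -> connect r x (s a).
    rewrite -[x]sK; move: (val x) (valP x) => {}x xe.
    rewrite sef // kf eqxx /= => /orP [xf|xg].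
      by apply: (arc f) => //; left.
    apply: (@connect_trans _ _ (s b)); first by apply: (arc g) => //; right.
    by apply/connect1/(rI v); rewrite ?sve ?sef // kf ?af // bg eqxx orbT.
  by apply: connect_trans (toa _ dk) _; rewrite r_sym toa.
Qed.

Lemma merge_tree : tree_cx Q.
Proof.
split.
- exact: merge_regular.
- by move=> a b abE; apply/val_inj/(tc_simple TP); exact: abE.
- by apply/card_gt0P; exists (merge_facet f).
- move=> v; have [d vd] := tc_vert TP v.
  have [de|de] := eqVneq d e; last by exists (Sub d de).
  rewrite de in vd; have [a [ae va _]] := other_side R vd hf.
  by exists (Sub a ae).
- move=> d; have /andP [d0 d2] := tc_edge TP (val d); apply/andP; split.
    have /card_gt0P [h] := d0; rewrite inE => dh.
    by apply/card_gt0P; exists (merge_facet h); rewrite inE merge_ef.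
  apply: leq_trans d2; apply: leq_trans (leq_imset_card merge_facet _).
  apply: subset_leq_card; apply/subsetP=> k; rewrite inE => /merge_ef_lift.
  by case=> h [<- dh _]; apply: imset_f; rewrite inE.
- move=> h k; rewrite -[h]merge_facetK -[k]merge_facetK.
  apply: connect_map (tc_connected TP (val h) (val k)) => a b.
  by case/existsP=> d /and3P [_ da db]; exact: (@merge_adj predT d a b).
- move=> d h k hk dh dk.
  have [h0 [h0E dh0 ch]] := merge_ef_lift dh.
  have [k0 [k0E dk0 ck]] := merge_ef_lift dk.
  have hk0 : h0 != k0 by apply: contra_neq hk => E; rewrite -h0E -k0E E.
  (* A route in [Q] avoiding [d] lifts to one in [P] avoiding [d], with passages between [f] and [g]
     across [e]. *)
  apply: contra (tc_bridge TP hk0 dh0 dk0) => hkc.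
  have := ch d; rewrite facet_adj_sym => {}ch.
  apply: connect_trans ch (connect_trans _ (ck d)).
  apply: connect_map hkc => a b /existsP [x /and3P [xd xa xb]].
  have [a0 [_ xa0 ca]] := merge_ef_lift xa; have [b0 [_ xb0 cb]] := merge_ef_lift xb.
  have := cb d; rewrite facet_adj_sym => {}cb.
  apply: connect_trans (ca d) (connect_trans _ cb).
  by apply/connect1/(@facet_adjI _ _ (val x)).
- move=> v h k /merge_vf [h0 <- vh] /merge_vf [k0 <- vk].
  apply: connect_map (tc_link TP vh vk) => a b /existsP [d /and3P [vd da db]].
  have := @merge_adj (@ve P v) d a b vd da db; exact.
Qed.

(** Two facets that become equal are [f] and [g], which share no edge but [e]. So merging does not
    change which edges form the boundary. *)
Lemma merge_interior (d : edge Q) :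
  (exists h k : facet Q, [/\ h != k, ef d h & ef d k]) <->
  (exists h k : facet P, [/\ h != k, ef (val d) h & ef (val d) k]).
Proof.
split=> -[h [k [hk dh dk]]].
  have [h0 [h0E dh0 _]] := merge_ef_lift dh; have [k0 [k0E dk0 _]] := merge_ef_lift dk.
  by exists h0, k0; split=> //; apply: contra_neq hk => E; rewrite -h0E -k0E E.
exists (merge_facet h), (merge_facet k); split; try exact: merge_ef.
apply: contra_neq hk => /merge_facet_inj [//|[eh ek]].
have := valP d.
case: (shared_edge_facets eh) (shared_edge_facets ek) => hE [] kE; rewrite hE kE // in dh dk *.
  by rewrite (shared_edge_unique dh dk) eqxx.
by rewrite (shared_edge_unique dk dh) eqxx.
Qed.

Lemma merge_homeo : pl_homeo Q P.
Proof.
have /card_gt0P [u] : 0 < #|ends e| by rewrite (edge_ends R).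
rewrite inE => /(other_end R) [w [uw _ enE]].
pose f' : facet Q := merge_facet f.
have vf' : val f' = f by rewrite val_merge_facet fg.
(* Splitting the merged facet again, with the sides of [g] other than [e] as [B], recovers [P];
   [insub] sends [e] and [g] to the new cells [None]. *)
pose B := [set d : edge Q | ef (val d) g].
have iso : cx_iso P (split_facet f' B u w).
  exists id, (fun d => insub d : edge (split_facet f' B u w)),
         (fun h => insub h : facet (split_facet f' B u w)).
  split.
  - by exists id.
  - exists (fun d : option {d | d != e} => oapp val e d) => [d|[d|]] /=.
    + by case: insubP => [x _ <- //|]; rewrite negbK => /eqP ->.
    + by rewrite valK.
    + by rewrite insubF ?eqxx.
  - exists (fun h : option {h | h != g} => oapp val g h) => [h|[h|]] /=.
    + by case: insubP => [x _ <- //|]; rewrite negbK => /eqP ->.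
    + by rewrite valK.
    + by rewrite insubF ?eqxx.
  - move=> v d /=; case: insubP => [x _ <- //|]; rewrite negbK => /eqP ->.
    by rewrite -enE inE.
  - move=> d h /=; case: insubP => [x _ <-|]; last first.
      rewrite negbK => /eqP ->; case: insubP => [y _ <-|]; last first.
        by rewrite negbK => /eqP ->.
      rewrite -val_eqE vf' /=; apply/eqP/idP => [-> //|].
      by case/shared_edge_facets => // E; have := valP y; rewrite /= E eqxx.
    case: insubP => [y _ <-|]; last by rewrite negbK inE => /eqP ->.
    rewrite -val_eqE vf' inE /=; have [yf|yf] := eqVneq (val y) f; last by rewrite orbF andbT.
    rewrite yf /=; case xg: (ef (val x) g); last by rewrite orbF andbT.
    rewrite orbT /=; apply/esym/negP=> xf.
    by have := valP x; rewrite /= (shared_edge_unique xf xg) eqxx.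
apply: PLTrans (PLIso (cx_iso_sym iso)); apply: PLSplitFacet.
- exact: merge_regular.
- by apply/subsetP=> d; rewrite !inE /= vf' eqxx => ->; rewrite orbT.
- exact: cx_iso_regular iso R.
Qed.

End Merge.

(** * Tree-like complexes are disks *)

Section CycleEdges.

Variable P : cellcx.
Hypotheses (R : regular_cx P) (SI : injective (@ends P)).
Variable c : seq (vert P).
Hypothesis cc : is_cycle (@EG P) c.

Lemma cycle_edgeP v : v \in c -> v != next c v /\ exists e, ve v e && ve (next c v) e.
Proof.
case/andP: cc => _ /andP [cyc _] vc; have := next_cycle cyc vc.
by case/andP=> -> /existsP.
Qed.

Lemma card_cycle_edges_at v : v \in c ->
  #|[set e in cycle_edges c | ve v e]| = 2.
Proof.
case/andP: (cc) => sc /andP [cyc uc] vc.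
have [vn [e1 /andP [v1 n1]]] := cycle_edgeP vc.
have pc : prev c v \in c by rewrite mem_prev.
have [] := cycle_edgeP pc; rewrite next_prev // => pv [e2 /andP [p2 v2]].
have np := next_neq_prev sc uc vc.
have e12 : e1 != e2.
  apply: contra_neq np => E; rewrite -E in p2.
  have : prev c v \in ends e1 by rewrite inE.
  by rewrite (ends_pair R vn v1 n1) !inE (negbTE pv) => /eqP ->.
transitivity #|[set e1; e2]|; last by rewrite cards2 e12.
apply: eq_card => e; rewrite !inE; apply/andP/orP.
  case=> /exists_inP [w wc /andP [we ne]] ve_.
  have [wn _] := cycle_edgeP wc.
  have : v \in ends e by rewrite inE.
  rewrite (ends_pair R wn we ne) => /set2P [] vE; [left|right]; apply/eqP.
    by rewrite -vE in ne we; apply: (edge_unique R SI vn).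
  have wE : w = prev c v by rewrite vE prev_next.
  by rewrite wE in we; apply: (edge_unique R SI pv).
case=> /eqP ->; split=> //; apply/exists_inP.
  by exists v; rewrite ?v1.
by exists (prev c v); rewrite ?next_prev ?p2.
Qed.

Lemma card_cycle_edges : (forall v, v \in c) -> #|cycle_edges c| = #|vert P|.
Proof.
move=> all_c; have := sum_card_swap [set: vert P] (cycle_edges c) (@ve P).
rewrite (eq_bigr (fun=> 2)); last by move=> v _; rewrite card_cycle_edges_at.
rewrite [RHS](eq_bigr (fun=> 2)); last first.
  by move=> e _; rewrite -(edge_ends R e); apply: eq_card => v; rewrite !inE.
by rewrite !sum_nat_const cardsT; lia.
Qed.

End CycleEdges.

Lemma next_nth_ord (T : eqType) (x0 : T) (s : seq T) (i : 'I_(size s)) :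
  uniq s -> next s (nth x0 s i) = nth x0 s (ordS i).
Proof.
move=> us; rewrite next_nth mem_nth //; case: s us i => [_ []//|y p] us i.
rewrite index_uniq //=; have := ltn_ord i; rewrite /= ltnS leq_eqVlt => /orP [/eqP iE|ip].
  by rewrite iE modnn nth_default // iE.
by rewrite modn_small // (set_nth_default x0).
Qed.

Lemma polygon_iso (P : cellcx) (c : seq (vert P)) (f0 : facet P) :
  regular_cx P -> injective (@ends P) -> hamiltonian_cycle (@EG P) c ->
  cycle_edges c = setT -> (forall f : facet P, f = f0) -> (forall e, ef e f0) ->
  cx_iso (polygon (size c)) P.
Proof.
move=> R SI [cc all_c] cE fE hef.
have /andP [sc /andP [cyc uc]] := cc.
have [v0 v0c] : exists v0, v0 \in c by case: (c) sc => // v s _; exists v; rewrite mem_head.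
have [_ [e0 _]] := cycle_edgeP cc v0c.
pose iV (i : 'I_(size c)) := nth v0 c i.
have iVc i : iV i \in c by rewrite mem_nth.
have iVn i : next c (iV i) = iV (ordS i) by exact: next_nth_ord.
pose iE (i : 'I_(size c)) := odflt e0 [pick e | ve (iV i) e && ve (iV (ordS i)) e].
have iVS i : iV i != iV (ordS i) by rewrite -iVn; case: (cycle_edgeP cc (iVc i)).
have iEP i : ends (iE i) = [set iV i; iV (ordS i)].
  rewrite /iE; case: pickP => [e /andP [h1 h2]|no]; first exact: (ends_pair R).
  by have [_ [e]] := cycle_edgeP cc (iVc i); rewrite iVn no.
have iV_inj : injective iV.
  by move=> i j /eqP; rewrite nth_uniq // => /eqP /val_inj.
have cV : #|vert P| = size c by rewrite -(card_uniqP uc); apply: eq_card => v; rewrite all_c.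
exists iV, iE, (fun=> f0); split.
- by apply: inj_card_bij => //; rewrite cV card_ord.
- apply: inj_card_bij; last by rewrite card_ord -cV -(card_cycle_edges R SI cc all_c) cE cardsT.
  (* Two steps of the cycle along one edge would run in opposite directions, so the cycle would
     return after two steps, although its length exceeds 2. *)
  move=> i j ij; apply/eqP/negPn/negP=> nij.
  have E : [set iV i; iV (ordS i)] = [set iV j; iV (ordS j)] by rewrite -!iEP ij.
  have : iV i \in [set iV j; iV (ordS j)] by rewrite -E set21.
  have : iV (ordS i) \in [set iV j; iV (ordS j)] by rewrite -E set22.
  rewrite !in_set2 !(inj_eq iV_inj) (negbTE nij) /= => h /eqP iE'.
  case/orP: h => /eqP jE; last by have := iVS i; rewrite jE -iE' eqxx.
  have := next_next_neq sc uc (iVc i).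
  by rewrite !iVn jE -iE' eqxx.
- by exists (fun=> tt) => [[]|f] //; rewrite fE.
- move=> i j /=; have /setP/(_ (iV i)) := iEP j.
  by rewrite !inE !(inj_eq iV_inj).
- by move=> e f /=; rewrite hef.
Qed.

(** Induction on the number of facets. Merging keeps the vertex set, so the Hamiltonian cycle of the
    merged complex serves for [P] unchanged. *)
Lemma tree_cx_disk (P : cellcx) : tree_cx P ->
  exists c, [/\ hamiltonian_cycle (@EG P) c, is_disk P &
    forall e, e \in cycle_edges c <-> ~ exists f g, [/\ f != g, ef e f & ef e g]].
Proof.
have [n] := ubnP #|facet P|; elim: n P => // n IH P lt TP.
have R := tc_regular TP; have SI := @tc_simple _ TP.
have [/existsP [e /existsP [f /existsP [g /and3P [fg hf hg]]]]|no] :=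
    boolP [exists e, exists f, exists g : facet P, [&& f != g, ef e f & ef e g]].
  have TQ := merge_tree TP fg hf hg.
  have [|c [[cc all_c] [m [m3 mQ]] cE]] := IH _ _ TQ.
    move: lt; rewrite (cardD1 g) add1n ltnS card_sig; apply: leq_trans.
    by rewrite ltnS; apply/eq_leq/eq_card => h; rewrite !inE andbT.
  have /andP [sc /andP [cyc uc]] := cc.
  exists c; split.
  - split=> //; apply/and3P; split=> //; apply: sub_cycle cyc => a b /andP [ab].
    by case/existsP=> d vd; rewrite /EG /= ab; apply/existsP; exists (val d).
  - by exists m; split=> //; apply: PLTrans mQ (merge_homeo TP fg hf hg).
  move=> d; have [->|de] := eqVneq d e.
    split=> [|[]]; last by exists f, g.
    rewrite inE => /exists_inP [v vc /andP [ve1 ne1]]; exfalso.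
    have [vn [d' /andP [vd nd]]] := cycle_edgeP cc vc.
    by have := valP d'; rewrite /= (edge_unique R SI vn vd nd ve1 ne1) eqxx.
  rewrite -[d]/(val (Sub d de : {d : edge P | d != e})).
  have := cE (Sub d de); rewrite (merge_interior TP fg hf hg (Sub d de)) => <-.
  by rewrite !inE.
(* Base case: with no shared edge, connectedness leaves a single facet, and its boundary is the
   whole graph. *)
have eqF e (f g : facet P) : ef e f -> ef e g -> f = g.
  move=> hf hg; apply: contraNeq no => fg.
  by apply/existsP; exists e; apply/existsP; exists f; apply/existsP; exists g; rewrite fg hf.
have /card_gt0P [f0 _] := tc_nonempty TP.
have fE (f : facet P) : f = f0.
  apply/esym/eqP; apply: (@connect_stay _ _ (pred1 f) _ _ _ (tc_connected TP f f0)).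
    by move=> a b /existsP [e /and3P [_ ea eb]]; rewrite (eqF e a b).
  exact: eqxx.
have hef e : ef e f0.
  have /andP [/card_gt0P [f]] := tc_edge TP e.
  by rewrite inE (fE f).
have vff v : vf v f0 by have [e hv] := tc_vert TP v; apply: vfI hv (hef e).
have e2 (v : vert P) : #|[set e | ve v e]| = 2.
  by rewrite -(facet_two R (vff v)); apply: eq_card => e; rewrite !inE hef andbT.
have [v0 _] : exists v0 : vert P, true.
  have /set0Pn [e _] := facet_sides R f0.
  have /card_gt0P [v _] : 0 < #|ends e| by rewrite (edge_ends R).
  by exists v.
have [c [cc all_c]] : exists c, hamiltonian_cycle (@EG P) c.
  apply: (two_regular_hamiltonian (@EG_sym P) (@EG_irr P) v0) => [v|u v].
    by rewrite (deg_EG R SI).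
  apply: connect_sub (bdry_connect R (vff u) (vff v)) => a b /andP [ab].
  case/existsP=> e /and3P [ha hb _]; apply: connect1; rewrite /EG /= ab.
  by apply/existsP; exists e; rewrite ha.
have cT : cycle_edges c = setT.
  apply/setP=> e; rewrite [RHS]inE.
  have /card_gt0P [v] : 0 < #|ends e| by rewrite (edge_ends R).
  rewrite inE => hv.
  have : [set e in cycle_edges c | ve v e] == [set e | ve v e].
    rewrite eqEcard e2 (card_cycle_edges_at R SI cc (all_c v)) leqnn andbT.
    by apply/subsetP=> x /setIdP [_ vx]; rewrite inE.
  by move/eqP/setP/(_ e); rewrite !inE hv andbT.
exists c; split=> //.
  exists (size c); split; first by case/andP: cc.
  by apply/PLIso/(@polygon_iso _ _ f0).
move=> e; rewrite cT inE; split=> // _ [f [g []]].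
by rewrite (fE f) (fE g) eqxx.
Qed.

(** * Unions of facets, and proper trees *)

Lemma disk_euler (P : cellcx) : is_disk P -> #|vert P| + #|facet P| = #|edge P| + 1.
Proof.
case=> n [_ /pl_homeo_euler] /=; rewrite !card_ord card_unit.
by move: #|vert P| #|facet P| #|edge P| => a b c; lia.
Qed.

Lemma disk_facet_connected (P : cellcx) : is_disk P -> facet_connected_cx P.
Proof. by case=> n [_ /pl_homeo_facet_connected <-] [] []. Qed.

Section FacetsCx.

Variables (K : cellcx) (A : {set facet K}).
Let P := facets_cx A.

Definition inner_edges : {set edge K} := [set e | #|[set f in A | ef e f]| == 2].

Lemma edge_in_facets e f : f \in A -> ef e f -> [exists f in A, ef e f].
Proof. by move=> fA he; apply/exists_inP; exists f. Qed.

Lemma vert_in_facets v f : f \in A -> vf v f -> [exists f in A, vf v f].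
Proof. by move=> fA hv; apply/exists_inP; exists f. Qed.

Lemma facets_cx_vf (v : vert P) (f : facet P) : vf v f = vf (val v) (val f).
Proof.
apply/existsP/existsP=> -[e]; first by exists (val e).
move=> /andP [he hf]; exists (Sub e (edge_in_facets (valP f) hf)).
by rewrite /= he hf.
Qed.

Lemma facets_cx_ends (e : edge P) : ends (val e) = val @: ends e.
Proof.
apply/setP=> v; rewrite inE; apply/idP/imsetP => [hv|[w]]; last by rewrite inE => H ->.
have /exists_inP [f fA hf] := valP e.
by exists (Sub v (vert_in_facets fA (vfI hv hf))); rewrite ?inE.
Qed.

Lemma facets_cx_adj (D : pred (edge K)) (f0 : facet P) e (a b : facet K) :
  D e -> a \in A -> b \in A -> ef e a -> ef e b ->
  @facet_adj P (fun x => D (val x)) (insubd f0 a) (insubd f0 b).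
Proof.
move=> De aA bA ea eb.
apply: (@facet_adjI P _ (Sub e (edge_in_facets aA ea))) => //.
  by rewrite -[ef _ _]/(ef e (val (insubd f0 a))) val_insubd aA.
by rewrite -[ef _ _]/(ef e (val (insubd f0 b))) val_insubd bA.
Qed.

Lemma facets_cx_simple : injective (@ends K) -> injective (@ends P).
Proof. by move=> SI a b abE; apply/val_inj/SI; rewrite !facets_cx_ends abE. Qed.

Lemma facets_cx_regular : regular_cx K -> regular_cx P.
Proof.
move=> R; split.
- by move=> e; rewrite -(edge_ends R (val e)) facets_cx_ends card_imset //; exact: val_inj.
- move=> f; have /set0Pn [e] := facet_sides R (val f); rewrite inE => he.
  by apply/set0Pn; exists (Sub e (edge_in_facets (valP f) he)); rewrite inE.
- move=> v f; rewrite facets_cx_vf => /(facet_two R) <-.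
  rewrite -(card_imset _ val_inj); apply: eq_card => e; rewrite inE.
  apply/imsetP/idP => [[x]|/andP [hv hf]]; first by rewrite inE => H ->.
  by exists (Sub e (edge_in_facets (valP f) hf)); rewrite ?inE //= hv hf.
- move=> f d d'; rewrite !inE => df df'.
  pose s x : edge P := insubd d x.
  have vs x : ef x (val f) -> val (s x) = x.
    by move=> xf; rewrite val_insubd (edge_in_facets (valP f) xf).
  have sK x : s (val x) = x by apply: val_inj; rewrite val_insubd (valP x).
  rewrite -[d]sK -[d']sK.
  have conn := @facet_connected _ R (val f) (val d) (val d'); rewrite !inE in conn.
  apply: connect_map (conn df df') => a b /and3P [af bf /existsP [v /andP [va vb]]].
  have saf : ef (s a) f by rewrite -[ef _ _]/(ef (val (s a)) (val f)) vs.
  have sbf : ef (s b) f by rewrite -[ef _ _]/(ef (val (s b)) (val f)) vs.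
  apply: connect1; apply/and3P; split=> //; apply/existsP.
  exists (Sub v (vert_in_facets (valP f) (vfI va af))); apply/andP; split.
    by rewrite -[ve _ _]/(ve v (val (s a))) vs.
  by rewrite -[ve _ _]/(ve v (val (s b))) vs.
Qed.

Lemma card_facets_cx_facet : #|facet P| = #|A|.
Proof. by rewrite /= card_sig; apply: eq_card => f; rewrite !inE. Qed.

Hypothesis R' : regular_cx (dual K).

Lemma card_edge_facets_le e : #|[set f in A | ef e f]| <= 2.
Proof.
rewrite -(edge_ends R' e); apply: subset_leq_card.
by apply/subsetP=> f; rewrite !inE => /andP [].
Qed.

Lemma card_facets_cx_edge : #|edge P| = #|boundary_edges A| + #|inner_edges|.
Proof.
have -> : #|edge P| = #|boundary_edges A :|: inner_edges|.
  rewrite /= card_sig; apply: eq_card => e; rewrite !inE.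
  have [/exists_inP [f fA he]|no] := boolP [exists f in A, ef e f].
    have : 0 < #|[set f in A | ef e f]| by apply/card_gt0P; exists f; rewrite inE fA.
    by have := card_edge_facets_le e; case: #|_| => [|[|[|]]].
  rewrite (_ : [set f in A | ef e f] = set0) ?cards0 //.
  apply/setP=> f; rewrite !inE; apply: contraNF no => /andP [fA he].
  exact: edge_in_facets he.
rewrite cardsU (_ : _ :&: _ = set0) ?cards0 ?subn0 //.
by apply/setP=> e; rewrite !inE; case: #|_| => [|[|[]]].
Qed.

Lemma sum_sides :
  \sum_(f in A) #|sides f| = #|boundary_edges A| + 2 * #|inner_edges|.
Proof.
have := sum_card_swap A [set: edge K] (fun f e => ef e f).
rewrite (eq_bigr (fun f => #|sides f|)); last first.
  by move=> f _; apply: eq_card => e; rewrite !inE.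
move=> ->; rewrite -!sum1dep_card big_distrr /= [in X in _ = X + _]big_mkcond.
rewrite [in X in _ = _ + X]big_mkcond -big_split /=; apply: eq_big => [e|e _].
  by rewrite inE.
by have := card_edge_facets_le e; case: #|_| => [|[|[|]]].
Qed.

End FacetsCx.

(** * From proper trees to Hamiltonian cycles *)

Section ProperTree.

Variable K : cellcx.
Hypothesis hK : polyhedral_map K.
Let M := dual K.
Let R := map_regular (proj1 hK).
Let R' := map_manifold (proj1 hK).
Let SI := @map_simple _ (proj1 hK).
Let SI' : injective (@ends M) := @map_simple _ (proj1 (dual_polyhedral_map hK)).

Lemma sum_deg_dual (A : {set vert M}) :
  \sum_(f in A) deg (@EG M) f =
  #|boundary_edges (A : {set facet K})| + 2 * #|inner_edges (A : {set facet K})|.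
Proof.
rewrite -(sum_sides _ R'); apply: eq_bigr => f _.
by rewrite (deg_EG R' SI').
Qed.

Lemma dual_shared_edge (f g : facet K) d e :
  f != g -> ef d f -> ef d g -> ef e f -> ef e g -> d = e.
Proof. exact: (@edge_unique M R' SI'). Qed.

Variables (S : {set vert M}) (t : rel (vert M)).
Hypothesis PT : proper_tree #|vert K| S t.
Let T := proper_is_tree PT.
Let P := @facets_cx K S.

(* Around a vertex, a path joining two adjacent facets is either their common *)
(* edge or goes all the way round, and the latter is too long.                *)
Lemma proper_tree_induced f g : f \in S -> g \in S -> EG f g -> t f g.
Proof.
move=> fS gS /andP [fg /existsP [e /andP [he_f he_g]]].
have /card_gt0P [v] : 0 < #|@ends K e| by rewrite (edge_ends R).
rewrite inE => hv.
have vF (h : vert M) : @ve M h e -> @vf M h v by move=> eh; apply: (@vfI M h e v).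
have [p [/andP [bp up] lp tp]] := proper_joined PT fS gS (vF f he_f) (vF g he_g).
case: p bp up lp tp => [|h [|h' p]]; first by move=> _ _ /= fE; rewrite fE eqxx in fg.
  by move=> _ _ /= -> /andP [].
set q := [:: h, h' & p] => bp up lp tp.
have sp : simple_path t f q by rewrite /simple_path tp.
have short := proper_short PT fS (vF f he_f) sp bp.
have bgf : @bdry M v g f.
  by rewrite /bdry /= eq_sym fg; apply/existsP; exists e; apply/and3P.
have cq : is_cycle (@bdry M v) (f :: q).
  apply/andP; split=> //; apply/andP; split=> //.
  by rewrite -[cycle _ _]/(path (@bdry M v) f (rcons q f)) rcons_path bp lp.
have : #|[set k | @vf M k v]| <= size (f :: q).
  rewrite -(card_uniqP up); apply: subset_leq_card; apply/subsetP=> k.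
  rewrite inE => vk; apply: (cycle_covers (@bdry_sym M v) cq).
  - by move=> z; apply: (deg_bdry_le R' SI').
  - exact: mem_head.
  - exact: (@bdry_connect M R' v f k (vF f he_f) vk).
rewrite (card_verts_facet R') => le; move: (leq_trans short le).
by rewrite /= addn2 ltnn.
Qed.

Lemma proper_tree_cx : tree_cx P.
Proof.
have /set0Pn [f1 f1S] := tree_nonempty T.
pose f0 : facet P := Sub f1 f1S.
have tS a b : t a b -> [/\ a \in S, b \in S & EG a b].
  by move/(tree_sub T)/and3P.
have valKd (f : facet P) : insubd f0 (val f) = f by apply: val_inj; rewrite val_insubd (valP f).
split.
- exact: facets_cx_regular R.
- exact: facets_cx_simple SI.
- by apply/card_gt0P; exists f0.
- move=> v; have /exists_inP [f fS /existsP [e /andP [hv hf]]] := valP v.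
  by exists (Sub e (edge_in_facets fS hf)).
- move=> e; have /exists_inP [f fS hf] := valP e; apply/andP; split.
    by apply/card_gt0P; exists (Sub f fS); rewrite inE.
  rewrite -(edge_ends R' (val e)) -(card_imset _ val_inj); apply: subset_leq_card.
  by apply/subsetP=> g /imsetP [x]; rewrite inE => H ->; rewrite inE.
- move=> f g; rewrite -[f]valKd -[g]valKd.
  apply: connect_map (tree_connected T (valP f) (valP g)) => a b /tS [aS bS].
  case/andP=> _ /existsP [e /andP [ea eb]]; apply: connect1.
  exact: (@facets_cx_adj K S predT f0 e a b).
- move=> e f g fg hf hg; apply/negP.
  (* The tree without the edge between [f] and [g]. Facets sharing an edge other than [e] are never
     this pair, so a route avoiding [e] is a [t']-path; with the removed edge it closes to a cycle
     of the tree. *)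
  pose t' : rel (vert M) := [rel a b | t a b && ([set a; b] != [set val f; val g])].
  have vfg : val f != val g by rewrite val_eqE.
  have step a b : facet_adj (predC1 e) a b -> connect t' (val a) (val b).
    case/existsP=> x /and3P [xe xa xb].
    have [->//|ab] := eqVneq a b; apply: connect1.
    have vab : val a != val b by rewrite val_eqE.
    apply/andP; split.
      apply: proper_tree_induced; [exact: (valP a) | exact: (valP b) |].
      by apply/andP; split=> //; apply/existsP; exists (val x); apply/andP.
    apply: contra xe => /eqP E; apply/eqP/val_inj/(dual_shared_edge vfg) => //.
      have : val f \in [set val a; val b] by rewrite E set21.
      by case/set2P=> ->.
    have : val g \in [set val a; val b] by rewrite E set22.
    by case/set2P=> ->.
  move/(connect_map step)/connectP=> [p0 tp0].
  case/shortenP: tp0 => p tp up _ lp.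
  case: p tp up lp => [|a [|b p]] tp up lp.
  + by rewrite lp eqxx in vfg.
  + have lp' : val g = a := lp.
    by case/andP: tp => /andP [_]; rewrite lp' eqxx.
  have := tree_acyclic T [:: val f, a, b & p]; case/negP.
  have /and3P [t1 t2 t3] : path t (val f) [:: a, b & p].
    by apply: sub_path tp => x y /andP [].
  apply/andP; split=> //; apply/andP; split=> //.
  rewrite -[cycle _ _]/(path t (val f) (rcons [:: a, b & p] (val f))) rcons_path.
  rewrite -lp (tree_sym T); apply/andP; split; first by apply/and3P.
  apply: proper_tree_induced; [exact: (valP f) | exact: (valP g) |].
  by apply/andP; split=> //; apply/existsP; exists (val e); apply/andP.
- move=> v f g; rewrite !facets_cx_vf -!(vf_dual (val v)) => vf1 vg1.
  have [p [/andP [bp _] lp tp]] := proper_joined PT (valP f) (valP g) vf1 vg1.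
  rewrite -[f]valKd -[g]valKd -lp.
  apply: (@connect_map _ [rel a b | t a b && @bdry M (val v) a b] _ _ (insubd f0)).
    move=> a b /andP [/tS [aS bS _] /andP [_ /existsP [e /and3P [ea eb ev]]]].
    by apply: connect1; apply: (@facets_cx_adj K S (ve (val v)) f0 e a b).
  by apply/connectP; exists p => //; rewrite path_relI tp.
Qed.

Lemma hamiltonian_of_proper_tree :
  exists c : seq (vert K), hamiltonian_cycle (@EG K) c /\ contractible c.
Proof.
have TP := proper_tree_cx.
have [c [[cc all_c] disk cE]] := tree_cx_disk TP.
have RP := tc_regular TP; have SP := @tc_simple _ TP.
have bE : @boundary_edges K S = val @: cycle_edges c.
  apply/setP=> e; rewrite inE; apply/idP/imsetP.
    case/cards1P=> f fE.
    have /setIdP [fS hf] : f \in [set f in S | @ef K e f] by rewrite fE set11.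
    exists (Sub e (edge_in_facets fS hf)) => //; apply/cE => -[g [h [gh hg hh]]].
    have uniqF (k : facet P) : @ef K e (val k) -> val k = f.
      by move=> hk; apply/set1P; rewrite -fE inE hk (valP k).
    by case/eqP: gh; apply: val_inj; exact: etrans (uniqF g hg) (esym (uniqF h hh)).
  case=> x /cE no ->; have /exists_inP [f fS hf] := valP x.
  apply/cards1P; exists f; apply/setP=> g; rewrite !inE.
  apply/andP/eqP => [[gS hg]|-> //]; apply/eqP/negPn/negP=> gf; apply: no.
  by exists (Sub g gS), (Sub f fS); split.
have /andP [sc /andP [cyc uc]] := cc.
(* The boundary has [#|vert P|] edges. Euler's formula gives one inner edge fewer than facets, and
   the degree condition then forces the two vertex numbers to agree. *)
have cardV : #|vert P| = #|vert K|.
  have := disk_euler disk; have := proper_deg PT.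
  have S0 : 0 < #|S| by rewrite card_gt0 (tree_nonempty T).
  rewrite sum_deg_dual card_facets_cx_facet (card_facets_cx_edge _ R').
  rewrite bE (card_imset _ val_inj) (card_cycle_edges RP SP cc all_c).
  move: #|vert P| #|vert K| #|S| #|inner_edges _| S0 => a b m i; lia.
exists (map val c); split; last first.
  exists S; split=> //; rewrite bE; apply/setP=> e.
  have nextE (v : vert P) : next (map val c) (val v) = val (next c v).
    exact: (next_map val_inj).
  rewrite [RHS]inE; apply/imsetP/exists_inP.
    case=> x; rewrite inE => /exists_inP [v vc /andP [vx nx]] ->.
    by exists (val v); [exact: map_f | rewrite nextE; apply/andP].
  case=> _ /mapP [v vc ->]; rewrite nextE => /andP [hv hn].
  have [vn [x /andP [vx nx]]] := cycle_edgeP cc vc.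
  exists x; first by rewrite inE; apply/exists_inP; exists v; rewrite ?vx.
  have vvn : val v != val (next c v) by rewrite val_eqE.
  exact: (edge_unique R SI vvn).
split.
  apply/andP; split; first by rewrite size_map.
  apply/andP; split; last by rewrite map_inj_uniq //; exact: val_inj.
  rewrite cycle_map; apply: sub_cycle cyc => a b /andP [ab /existsP [x vx]].
  by apply/andP; split; [rewrite /= val_eqE | apply/existsP; exists (val x)].
move=> v.
have : val @: [set: vert P] == [set: vert K].
  by rewrite eqEcard subsetT (card_imset _ val_inj) !cardsT cardV /=.
move/eqP/setP/(_ v); rewrite inE => /imsetP [w _ ->].
exact: map_f.
Qed.

End ProperTree.

(** * From disks to proper trees *)

Section DiskTree.

Variable K : cellcx.
Hypothesis hK : polyhedral_map K.
Let M := dual K.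
Let R := map_regular (proj1 hK).
Let R' := map_manifold (proj1 hK).
Let SI := @map_simple _ (proj1 hK).
Let SI' : injective (@ends M) := @map_simple _ (proj1 (dual_polyhedral_map hK)).

Variables (c : seq (vert K)) (A : {set facet K}).
Hypotheses (cc : is_cycle (@EG K) c) (all_c : forall v, v \in c).
Hypotheses (disk : is_disk (facets_cx A)) (bE : boundary_edges A = cycle_edges c).

Definition disk_tree : rel (facet K) := [rel a b | [&& a \in A, b \in A & @EG M a b]].
Let t := disk_tree.

Lemma disk_treeI (a b : facet K) x :
  a \in A -> b \in A -> a != b -> ef x a -> ef x b -> t a b.
Proof.
by move=> aA bA ab xa xb; apply/and4P; split=> //; apply/existsP; exists x; apply/andP.
Qed.

Lemma disk_tree_sym : symmetric t.
Proof.
by move=> a b; apply/and3P/and3P => -[? ? ab]; split=> //; move: ab; rewrite (@EG_sym M).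
Qed.

Lemma shared_edge_in (a b : facet K) x : a \in A -> b \in A -> a != b ->
  ef x a -> ef x b -> [set f in A | ef x f] = [set a; b].
Proof.
move=> aA bA ab xa xb; apply/esym/eqP; rewrite eqEcard cards2 ab card_edge_facets_le // andbT.
by apply/subsetP=> z /set2P [] ->; rewrite inE ?aA ?bA.
Qed.

Lemma boundary_edge_at v : exists2 e, e \in boundary_edges A & ve v e.
Proof.
have := card_cycle_edges_at R SI cc (all_c v); rewrite -bE.
move=> c2; have /card_gt0P [e] : 0 < #|[set e in boundary_edges A | ve v e]| by rewrite c2.
by case/setIdP=> *; exists e.
Qed.

Lemma boundary_edge_facet e : e \in boundary_edges A -> exists2 f, f \in A & ef e f.
Proof.
rewrite inE => /cards1P [f fE].
by have := set11 f; rewrite -fE inE => /andP []; exists f.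
Qed.

Lemma boundary_edge_outside e : e \in boundary_edges A -> exists2 f, f \notin A & ef e f.
Proof.
move=> eb; have /subsetPn [k] : ~~ ([set k | ef e k] \subset [set k in A | ef e k]).
  apply/negP=> /subset_leq_card; rewrite [#|[set k | ef e k]|](edge_ends R' e).
  by move: eb; rewrite inE => /eqP ->.
by rewrite !inE => ek; rewrite ek andbT => kA; exists k.
Qed.

Lemma card_disk_verts : #|vert (facets_cx A)| = #|vert K|.
Proof.
rewrite /= card_sig; apply: eq_card => v; rewrite !inE.
have [e eb hv] := boundary_edge_at v; have [f fA hf] := boundary_edge_facet eb.
exact: vert_in_facets fA (vfI hv hf).
Qed.

(** Since the cycle is Hamiltonian, the disk contains all vertices of [K] and has as many boundary
    edges; these cancel in Euler's formula. *)
Lemma card_disk_inner : #|A| = #|inner_edges A| + 1.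
Proof.
have := disk_euler disk; rewrite card_disk_verts card_facets_cx_facet.
rewrite (card_facets_cx_edge _ R') bE (card_cycle_edges R SI cc all_c).
by move: #|vert K| #|A| #|inner_edges A| => n a i; lia.
Qed.

Lemma disk_tree_connected : {in A &, forall a b, connect t a b}.
Proof.
move=> a b aA bA.
have := disk_facet_connected disk (Sub a aA) (Sub b bA).
apply: (@connect_map _ _ _ t val) => x y /existsP [e /and3P [_ ex ey]].
have [->//|xy] := eqVneq x y.
apply/connect1/(@disk_treeI _ _ (val e)) => //; [exact: valP | exact: valP].
Qed.

(* Deleting one shared edge on a cycle of facets leaves the facets connected, *)
(* but there are only [#|A| - 1] shared edges.                                *)
Lemma disk_tree_acyclic s : ~~ is_cycle t s.
Proof.
apply/negP; case: s => [|f [|g [|h p]]] //.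
rewrite /is_cycle /= => /andP [cyc us].
set q := h :: p in us cyc.
have {cyc} : path t f (rcons (g :: q) f) by [].
rewrite rcons_path => /andP [/andP [tfg tq] tl].
have {}tl : t (last g q) f := tl.
have /and4P [fA gA fg /existsP [d /andP [df dg]]] := tfg.
have {}df : @ef K d f := df; have {}dg : @ef K d g := dg.
have dE := shared_edge_in fA gA fg df dg.
have fq : f \notin g :: q by case/andP: us.
pose D := inner_edges A :\ d.
pose r : rel (facet K) := [rel a b | [exists x in D,
  (a \in [set f in A | ef x f]) && (b \in [set f in A | ef x f])]].
have r_sym : connect_sym r.
  by apply: sym_connect_sym => a b; apply: eq_existsb => x; rewrite [X in _ && X]andbC.
(* The only facets of [A] on [d] are [f] and [g], so any other adjacency uses an edge of [D]. *)
have step a b : t a b -> ~~ [&& a \in [set f; g] & b \in [set f; g]] -> r a b.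
  case/and4P=> aA bA ab /existsP [x /andP [xa xb]] nab.
  have {}xa : @ef K x a := xa; have {}xb : @ef K x b := xb.
  apply/exists_inP; exists x; last by rewrite !inE aA bA xa xb.
  rewrite !inE (shared_edge_in aA bA ab xa xb) cards2 ab andbT.
  apply: contraNneq nab => xd; rewrite xd in xa xb.
  by rewrite -dE !inE aA bA xa xb.
have gl : connect r g (last g q).
  apply/connectP; exists q => //; apply: (@sub_in_path _ [pred z | z != f] t r _ g q _ tq).
    move=> a b af bf tab; apply: (step _ _ tab); rewrite !in_set2.
    rewrite !inE in af bf; rewrite (negbTE af) (negbTE bf) /=.
    apply/negP=> /andP [/eqP ag /eqP bg]; case/and4P: tab => _ _.
    by rewrite ag bg eqxx.
  by apply/allP=> z zq; apply: contraNneq fq => <-.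
have lg : last g q != g.
  have : g \notin q by case/and3P: us.
  by apply: contraNneq => <-; rewrite /q /= mem_last.
have lf : last g q != f by apply: contraNneq fq => <-; exact: mem_last.
have gf : connect r g f.
  apply: connect_trans gl (connect1 (step _ _ tl _)).
  by rewrite !in_set2 (negbTE lg) (negbTE lf).
have all_r a b : t a b -> connect r a b.
  move=> tab; have [/andP []|/(step _ _ tab)/connect1//] :=
    boolP [&& a \in [set f; g] & b \in [set f; g]].
  by case/set2P=> -> /set2P [] -> //; rewrite r_sym.
have dI : d \in inner_edges A by rewrite inE dE cards2 fg.
have : #|A| <= #|D| + 1.
  apply: (@card_connected_le _ _ (fun x => [set f in A | ef x f])).
    by move=> x _; exact: card_edge_facets_le.
  by move=> a b aA bA; apply: connect_sub all_r _ _ (disk_tree_connected aA bA).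
rewrite card_disk_inner (cardsD1 d (inner_edges A)) dI -/D.
by rewrite -addnA add1n ltnn.
Qed.

(** Parity again. For a component of the facets of [A] around [v], the edges at [v] on exactly one
    of its facets are even in number, and they are among the two boundary edges at [v]. So every
    component reaches both boundary edges, and any two components meet there. *)
Lemma disk_tree_joined v a b : a \in A -> b \in A -> vf v a -> vf v b ->
  connect [rel x y | t x y && @bdry M v x y] a b.
Proof.
move=> aA bA va vb; set r := (X in connect X).
have r_sym : connect_sym r.
  apply: sym_connect_sym => x y; rewrite -[LHS]/(t x y && @bdry M v x y).
  by rewrite disk_tree_sym (@bdry_sym M v).
pose U x := [set y | connect r x y].
have UP x y : x \in A -> vf v x -> y \in U x -> y \in A /\ vf v y.
  move=> xA vx; rewrite inE => xy.
  have : y \in [pred z | (z \in A) && vf v z].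
    apply: (connect_stay _ xy); last by rewrite inE xA.
    move=> z w /andP [/and3P [_ wA _] /andP [_ /existsP [e /and3P [_ ew ev]]]] _.
    by rewrite inE wA; apply: vfI ev ew.
  by rewrite inE => /andP.
have near x y z e : x \in A -> vf v x -> y \in U x -> z \in A -> ve v e ->
    ef e y -> ef e z -> z \in U x.
  move=> xA vx yU zA hv ey ez; have [<-//|yz] := eqVneq y z.
  have [yA _] := UP _ _ xA vx yU; move: yU; rewrite !inE => xy.
  apply: connect_trans xy (connect1 _); apply/andP; split.
    exact: (disk_treeI yA zA yz ey ez).
  by apply/andP; split=> //; apply/existsP; exists e; apply/and3P.
have reach x e : x \in A -> vf v x -> e \in boundary_edges A -> ve v e ->
    exists2 y, y \in U x & ef e y.
  move=> xA vx eb hv.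
  pose L := [set e | #|[set y in U x | ve v e && ef e y]| == 1].
  have evL : ~~ odd #|L|.
    apply: even_card_once => [y yU|d].
      by have [_ vy] := UP _ _ xA vx yU; exact: (facet_two R vy).
    apply: leq_trans (card_edge_facets_le A R' d); apply: subset_leq_card.
    apply/subsetP=> y /setIdP [yU /andP [_ dy]]; have [yA _] := UP _ _ xA vx yU.
    by rewrite inE yA.
  have Lsub : L \subset [set e in boundary_edges A | ve v e].
    apply/subsetP=> d; rewrite [d \in L]inE => /cards1P [y yE].
    have /setIdP [yU /andP [vd dy]] : y \in [set y in U x | ve v d && ef d y].
      by rewrite yE set11.
    have [yA _] := UP _ _ xA vx yU.
    rewrite inE vd andbT inE; apply/cards1P; exists y; apply/setP=> z.
    rewrite inE in_set1; apply/andP/eqP => [[zA dz]|-> //].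
    by apply/set1P; rewrite -yE inE vd dz (near x y z d).
  (* Going round [v] from [x] to a facet outside [A], one leaves the component across an edge
     counted by [L]. *)
  have L0 : L != set0.
    have [k kA ek] := boundary_edge_outside eb; have vk := vfI hv ek.
    have xU : x \in U x by rewrite inE connect0.
    have kU : k \notin U x by apply: contra kA => /(UP _ _ xA vx) [].
    have vx' : @vf M x v by rewrite vf_dual.
    have vk' : @vf M k v by rewrite vf_dual.
    have [y [z [/andP [yz /existsP [d /and3P [dy dz vd]]] yU zU]]] :=
      connect_exit (@bdry_connect M R' v x k vx' vk') xU kU.
    have {}dy : @ef K d y := dy; have {}dz : @ef K d z := dz.
    have {}vd : @ve K v d := vd; have [yA _] := UP _ _ xA vx yU.
    apply/set0Pn; exists d; rewrite inE; apply/cards1P; exists y.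
    apply/setP=> w; rewrite in_set1 inE; apply/andP/eqP => [[wU /andP [_ dw]]|->]; last first.
      by rewrite vd.
    have : w \in @ends M d by rewrite inE.
    rewrite (@ends_pair M R' y z d yz dy dz) => /set2P [//|wz].
    by rewrite wz (negbTE zU) in wU.
  have LE : L = [set e in boundary_edges A | ve v e].
    apply/eqP; rewrite eqEcard Lsub bE (card_cycle_edges_at R SI cc (all_c v)).
    by rewrite -card_gt0 in L0; case: #|L| L0 evL => [|[]].
  have : e \in L by rewrite LE inE eb.
  rewrite inE => /cards1P [y yE].
  have /setIdP [yU /andP [_ ey]] : y \in [set y in U x | ve v e && ef e y].
    by rewrite yE set11.
  by exists y.
have [e eb hv] := boundary_edge_at v.
have [x xU ex] := reach a e aA va eb hv; have [y yU ey] := reach b e bA vb eb hv.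
have [xA _] := UP _ _ aA va xU.
have := near b y x e bA vb yU xA hv ey ex; rewrite inE r_sym.
by move: xU; rewrite inE; apply: connect_trans.
Qed.

Lemma disk_proper_tree : proper_tree #|vert K| (A : {set vert M}) t.
Proof.
have [v0 _] : exists v0 : vert K, true.
  by have /card_gt0P [v _] := map_nonempty (proj1 hK); exists v.
split.
- split.
  + exact: disk_tree_sym.
  + by move=> a b.
  + have [e eb _] := boundary_edge_at v0; have [f fA _] := boundary_edge_facet eb.
    by apply/set0Pn; exists f.
  + exact: disk_tree_connected.
  + exact: disk_tree_acyclic.
- rewrite (sum_deg_dual hK) bE (card_cycle_edges R SI cc all_c) card_disk_inner.
  by rewrite addnK.
- move=> v a b aA bA; rewrite !vf_dual => va vb.
  have /connectP [p0 rp0 ->] := disk_tree_joined aA bA va vb.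
  case/shortenP: rp0 => p; rewrite path_relI => /andP [tp bp] up _.
  by exists p; split=> //; apply/andP.
(* The path visits only facets of [A] at [v], and at least one facet at [v] is outside [A], beyond a
   boundary edge; hence the 2 in the bound. *)
- move=> v a p aA va /andP [tp up] bp.
  pose X := [set f in A | @vf M f v].
  have pX : {subset a :: p <= X}.
    have aX : a \in X by rewrite inE aA.
    have /allP : all [in X] p.
      elim: p a {aA va up} aX tp bp => //= b p IH a aX /andP [tab tp] /andP [bab bp].
      have bX : b \in X.
        case/and3P: tab => _ bA _; rewrite inE bA.
        case/andP: bab => _ /existsP [e /and3P [_ eb ev]]; exact: (@vfI M b e v).
      by rewrite bX (IH b).
    by move=> H z; rewrite inE => /orP [/eqP ->//|/H].
  have le : (size p).+1 <= #|X|.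
    by rewrite -[_.+1]/(size (a :: p)) -(card_uniqP up); apply/subset_leq_card/subsetP.
  have lt : #|X| < #|[set f | @vf M f v]|.
    apply: proper_card; apply/properP; split.
      by apply/subsetP=> f; rewrite !inE => /andP [].
    have [e eb hv] := boundary_edge_at v.
    have [k kA ek] := boundary_edge_outside eb.
    exists k; rewrite ?inE ?(negbTE kA) //.
    by rewrite vf_dual; apply: vfI hv ek.
  by rewrite -(card_verts_facet R') addn2; exact: leq_ltn_trans le lt.
Qed.

End DiskTree.

Theorem theorem2 (K : cellcx) (hK : polyhedral_map K) :
  (exists c : seq (vert K), hamiltonian_cycle (@EG K) c /\ contractible c)
  <->
  (exists (S : {set vert (dual K)}) (t : rel (vert (dual K))),
     proper_tree #|vert K| S t).
Proof.
split=> [[c [[cc all_c] [A [disk bE]]]]|[S [t PT]]].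
  by exists A, (disk_tree A); apply: (@disk_proper_tree K hK c A).
exact: hamiltonian_of_proper_tree PT.
Qed.
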